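(* Let $a,b\in\mathbb{C}$, $r\in\mathbb{N}$, $\mathbf{m}=(m_1,\dots,m_r)\in\mathbb{N}^r$, $m=m_1+\cdots+m_r$, $\mathbf{f}=(f_1,\dots,f_r)\in\mathbb{C}^r$. Suppose $q\in\{0,\ldots,m-1\}$ and $\Re(a+q)<0$. Then $${}_{r+2}F_{r+1}\left(\begin{matrix}a,b,\mathbf{f}+\mathbf{m}\\ b+m-q,\mathbf{f}\end{matrix}\right)=\frac{\Gamma(b+m-q)\Gamma(1-a)R_{m-q-1}(a)}{\Gamma(b-a+m-q)(m-q-1)!},$$ where $$R_{m-q-1}(t)=\sum_{k=0}^{m}(b)_kC_{k,r}(-1)^k(1-t-k)_{m-q-1}.$$
   Context: $(z)_k=z(z+1)\cdots(z+k-1)$, $(z)_0=1$. ${}_pF_q$ with omitted argument is the value at $z=1$ of the generalized hypergeometric series $\sum_{n\ge0}\frac{(a_1)_n\cdots(a_p)_n}{(b_1)_n\cdots(b_q)_n}\frac{z^n}{n!}$; as usual, no bottom parameter is a nonpositive integer (here: $b+m-q$ and the $f_j$). In the parameter list, $\mathbf{f}$ means $f_1,\dots,f_r$ and $\mathbf{f}+\mathbf{m}$ means $f_1+m_1,\dots,f_r+m_r$. The coefficients are $C_{k,r}=\frac{(-1)^k}{k!}\,{}_{r+1}F_r\left(\begin{matrix}-k,\mathbf{f}+\mathbf{m}\\ \mathbf{f}\end{matrix}\right)=\frac{(-1)^k}{k!}\sum_{i=0}^k\frac{(-k)_i}{i!}\prod_{j=1}^r\frac{(f_j+m_j)_i}{(f_j)_i}$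 for $0\le k\le m$; in particular $C_{0,r}=1$, $C_{m,r}=1/\prod_{j=1}^r(f_j)_{m_j}$. The polynomial $R_{m-q-1}$ has the equivalent form (recalled in the paper from another work of the authors) $$R_{m-q-1}(t)=\sum_{k=0}^{m-q-1}\frac{(\mathbf{f}-b-k)_{\mathbf{m}}(b)_{k}}{(\mathbf{f})_{\mathbf{m}}\,k!}(q+1-m)_{k}(b+k+1-t)_{m-q-1-k},$$ with $(\mathbf{f}+s)_{\mathbf{m}}=\prod_{j=1}^r(f_j+s)_{m_j}$. *)

(* Defs.v *)
(* Stdlib reals, with Coquelicot's complex numbers and series. *)
From Stdlib Require Import Reals Factorial List.
From Coquelicot Require Import Coquelicot.
Import ListNotations.
Open Scope C_scope.

Fixpoint poch (z : C) (n : nat) : C :=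
  match n with
  | O => 1
  | S k => poch z k * (z + INR k)
  end.

Definition nonpos_int (z : C) : Prop := exists n : nat, z = - INR n.

Definition nat_cpow (n : nat) (s : C) : C :=
  exp (Re s * ln (INR n)) * (cos (Im s * ln (INR n)), sin (Im s * ln (INR n))).

(* Euler's definition: Gamma z = lim_k k! k^(z-1) / (z)_k for every z other
   than 0, -1, -2, ... (no restriction on Re z).  At a pole (z)_k vanishes for
   large k and division by 0 yields 0, so that Gamma z = 0 and hence
   / Gamma z = 0, the value there of the entire function 1/Gamma. *)
Definition Gamma_approx (z : C) (k : nat) : C :=
  INR (fact k) * nat_cpow k (z - 1) / poch z k.

Definition Gamma (z : C) : C :=
  (real (Lim_seq (fun k => Re (Gamma_approx z k))),
   real (Lim_seq (fun k => Im (Gamma_approx z k)))).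

Definition poch_prod (l : list C) (n : nat) : C :=
  fold_right Cmult 1 (map (fun x => poch x n) l).

Definition pFq_term (top bot : list C) (z : C) (n : nat) : C :=
  poch_prod top n / poch_prod bot n * (z ^ n / INR (fact n)).

(* The series converges, with sum [v]. *)
Definition is_pFq (top bot : list C) (z v : C) : Prop :=
  is_series (pFq_term top bot z) v.

(* An r-tuple is given by a function on nat of which only the values at
   0, ..., r-1 are used. *)
Definition params (r : nat) (f : nat -> C) : list C := map f (seq 0 r).

Definition shifted_params (r : nat) (f : nat -> C) (m : nat -> nat) : list C :=
  map (fun j => f j + INR (m j)) (seq 0 r).

Definition total (r : nat) (m : nat -> nat) : nat := list_sum (map m (seq 0 r)).

(* (-1)^k / k! times the value at 1 of the series with parameters
   -k, f + m over f; its terms of index larger than k vanish. *)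
Definition Ccoef (r : nat) (f : nat -> C) (m : nat -> nat) (k : nat) : C :=
  (- (1)) ^ k / INR (fact k) *
  sum_n (pFq_term (- INR k :: shifted_params r f m) (params r f) 1) k.

Definition Rpoly (b : C) (r : nat) (f : nat -> C) (m : nat -> nat) (q : nat)
    (t : C) : C :=
  sum_n (fun k => poch b k * Ccoef r f m k * (- (1)) ^ k *
                  poch (1 - t - INR k) (total r m - q - 1)) (total r m).

(* Main.v *)
(* Since (f + m)_n / (f)_n = (f + n)_m / (f)_m, the factor coming from the
   parameters f is a polynomial in n of degree m, and its Newton expansion at 0
   is sum_k C_k n (n - 1) ... (n - k + 1).  With c = b + m - q the k-th summand
   contributes (a)_k (b)_k / (c)_k 2F1(a + k, b + k; c + k), evaluated by
   Gauss's theorem because Re (c - a - b - k) >= Re (- q - a) > 0.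

   Gauss's theorem is proved from its contiguous relation between the bottom
   parameters c and c + 1: iterating it N times gives
   (c)_N (c-a-b)_N F(c) = (c-a)_N (c-b)_N F(c+N) with F(c+N) -> 1, and the
   Pochhammer symbols turn into Gamma functions by Euler's limit.  Working with
   the entire function 1/Gamma avoids all case distinctions at the poles. *)
Require Import Defs.
From Stdlib Require Import Reals Factorial List Arith Lra Lia Classical.
From Coquelicot Require Import Coquelicot.
Import ListNotations.
Open Scope C_scope.

(** * Limits and series of complex numbers *)

(** [Gamma] is built from [Lim_seq], which has a value even for a divergent sequence, so Euler's
    limit must be shown to converge. Consecutive approximants of 1/Gamma have the ratio (1 + s h) (1
    - h)^s with s = z - 1 and h = 1/(n+1); the terms linear in h cancel, so the ratio is 1 +
    O(1/n^2). The same limit does the work of Stirling's formula: the n-th term of 2F1(a, b; c; 1)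
    is a product of three approximants, all bounded, and of n^(a+b-c-1). Comparison with 1/n^2
    settles convergence only for Re (c-a-b) >= 1. The contiguous relation, read on partial sums,
    extends it to Re (c-a-b) > 0, so that it serves for convergence as well as for evaluation. In
    the final formula b - a + m - q may be a pole of Gamma. The series then has sum 0, and so has
    the right-hand side, because division by 0 yields 0. *)

(** Convergence is taken componentwise because [Gamma] is defined by the limits of the real and
    imaginary parts; facts about real sequences then transfer one component at a time. *)
Definition Clim_seq (u : nat -> C) (l : C) : Prop :=
  is_lim_seq (fun n => Re (u n)) (Re l) /\ is_lim_seq (fun n => Im (u n)) (Im l).

Lemma C_ext (x y : C) : Re x = Re y -> Im x = Im y -> x = y.
Proof. destruct x, y; simpl; intros -> ->; reflexivity. Qed.

Lemma im_le_Cmod (z : C) : (Rabs (Im z) <= Cmod z)%R.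
Proof.
  apply Rle_trans with (2 := Rmax_Cmod z), Rmax_r.
Qed.

Lemma Cmod_le_Re_Im (z : C) : (Cmod z <= Rabs (Re z) + Rabs (Im z))%R.
Proof.
  destruct z as [x y]; simpl.
  replace (x, y) with (RtoC x + Ci * RtoC y) by (apply C_ext; simpl; ring).
  eapply Rle_trans; [apply Cmod_triangle|].
  rewrite Cmod_mult, Cmod_Ci, !Cmod_R; lra.
Qed.

Lemma Clim_seq_const (l : C) : Clim_seq (fun _ => l) l.
Proof. split; apply is_lim_seq_const. Qed.

Lemma Clim_seq_plus (u v : nat -> C) (l l' : C) :
  Clim_seq u l -> Clim_seq v l' -> Clim_seq (fun n => u n + v n) (l + l').
Proof.
  intros [H1 H2] [H3 H4]; split; simpl; now apply is_lim_seq_plus'.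
Qed.

Lemma Clim_seq_mult (u v : nat -> C) (l l' : C) :
  Clim_seq u l -> Clim_seq v l' -> Clim_seq (fun n => u n * v n) (l * l').
Proof.
  intros [H1 H2] [H3 H4]; split; simpl.
  - now apply is_lim_seq_minus'; apply is_lim_seq_mult'.
  - now apply is_lim_seq_plus'; apply is_lim_seq_mult'.
Qed.

Lemma Clim_seq_ext_loc (u v : nat -> C) (l : C) :
  eventually (fun n => u n = v n) -> Clim_seq u l -> Clim_seq v l.
Proof.
  intros [N HN] [H1 H2]; split; eapply is_lim_seq_ext_loc; eauto;
    exists N; intros n Hn; now rewrite HN.
Qed.

Lemma Clim_seq_ext (u v : nat -> C) (l : C) :
  (forall n, u n = v n) -> Clim_seq u l -> Clim_seq v l.
Proof. intros H; apply Clim_seq_ext_loc; exists 0%nat; auto. Qed.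

Lemma Clim_seq_unique (u : nat -> C) (l l' : C) :
  Clim_seq u l -> Clim_seq u l' -> l = l'.
Proof.
  intros [H1 H2] [H3 H4]; apply C_ext.
  - apply is_lim_seq_unique in H1; apply is_lim_seq_unique in H3; congruence.
  - apply is_lim_seq_unique in H2; apply is_lim_seq_unique in H4; congruence.
Qed.

Lemma Clim_seq_incr_1 (u : nat -> C) (l : C) :
  Clim_seq (fun n => u (S n)) l <-> Clim_seq u l.
Proof.
  split; intros [H1 H2]; split.
  - now apply is_lim_seq_incr_1.
  - now apply is_lim_seq_incr_1.
  - now apply (is_lim_seq_incr_1 (fun n => Re (u n))).
  - now apply (is_lim_seq_incr_1 (fun n => Im (u n))).
Qed.

Lemma is_lim_seq_squeeze_0 (u v : nat -> R) :
  eventually (fun n => (Rabs (u n) <= v n)%R) ->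
  is_lim_seq v 0%R -> is_lim_seq u 0%R.
Proof.
  intros H Hv.
  apply is_lim_seq_abs_0.
  apply is_lim_seq_le_le_loc with (u := fun _ => 0%R) (w := v).
  - destruct H as [N HN]; exists N; intros n Hn; split; auto.
    apply Rabs_pos.
  - apply is_lim_seq_const.
  - exact Hv.
Qed.

Lemma Clim_seq_squeeze (u : nat -> C) (l : C) (v : nat -> R) :
  eventually (fun n => (Cmod (u n - l) <= v n)%R) ->
  is_lim_seq v 0%R -> Clim_seq u l.
Proof.
  intros [N HN] Hv; split.
  - apply is_lim_seq_ext with (u := fun n => (Re (u n - l) + Re l)%R).
    { intros n; unfold Re, Im; simpl; ring. }
    replace (Finite (Re l)) with (Finite (0 + Re l)) by (f_equal; ring).
    apply is_lim_seq_plus'; [|apply is_lim_seq_const].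
    apply is_lim_seq_squeeze_0 with v; auto.
    exists N; intros n Hn.
    eapply Rle_trans; [apply re_le_Cmod | now apply HN].
  - apply is_lim_seq_ext with (u := fun n => (Im (u n - l) + Im l)%R).
    { intros n; unfold Re, Im; simpl; ring. }
    replace (Finite (Im l)) with (Finite (0 + Im l)) by (f_equal; ring).
    apply is_lim_seq_plus'; [|apply is_lim_seq_const].
    apply is_lim_seq_squeeze_0 with v; auto.
    exists N; intros n Hn.
    eapply Rle_trans; [apply im_le_Cmod | now apply HN].
Qed.

Lemma Clim_seq_Cmod (u : nat -> C) (l : C) :
  Clim_seq u l -> is_lim_seq (fun n => Cmod (u n - l)) 0%R.
Proof.
  intros [H1 H2].
  apply is_lim_seq_squeeze_0 with
    (fun n => (Rabs (Re (u n) - Re l) + Rabs (Im (u n) - Im l))%R).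
  - exists 0%nat; intros n _. rewrite Rabs_pos_eq by apply Cmod_ge_0.
    apply (Cmod_le_Re_Im (u n - l)).
  - replace 0%R with (Rabs (Re l - Re l) + Rabs (Im l - Im l))%R
      by (rewrite !Rminus_diag, Rabs_R0; ring).
    apply is_lim_seq_plus'; apply (is_lim_seq_abs _ (Finite _));
      apply is_lim_seq_minus'; auto; apply is_lim_seq_const.
Qed.

Lemma Clim_seq_bounded (u : nat -> C) (l : C) :
  Clim_seq u l -> exists K, (0 < K)%R /\ forall n, (Cmod (u n) <= K)%R.
Proof.
  intros H.
  assert (Hb : exists N, forall n, (N <= n)%nat -> (Cmod (u n) <= Cmod l + 1)%R).
  { apply Clim_seq_Cmod in H.
    apply is_lim_seq_spec in H.
    destruct (H (mkposreal 1 Rlt_0_1)) as [N HN]; exists N; intros n Hn.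
    specialize (HN n Hn); simpl in HN.
    rewrite Rminus_0_r, Rabs_pos_eq in HN by apply Cmod_ge_0.
    replace (u n) with (l + (u n - l)) by ring.
    eapply Rle_trans; [apply Cmod_triangle|]; lra. }
  destruct Hb as [N HN].
  assert (Hf : exists K, forall n, (n < N)%nat -> (Cmod (u n) <= K)%R).
  { clear HN; induction N as [|N [K IH]].
    - exists 0%R; intros; lia.
    - exists (Rmax K (Cmod (u N))); intros n Hn.
      destruct (Nat.eq_dec n N) as [->|Hne]; [apply Rmax_r|].
      apply Rle_trans with K; [apply IH; lia | apply Rmax_l]. }
  destruct Hf as [K HK].
  exists (Rmax K (Cmod l + 1)); split.
  - apply Rlt_le_trans with (2 := Rmax_r _ _).
    generalize (Cmod_ge_0 l); lra.
  - intros n; destruct (Nat.lt_ge_cases n N) as [Hn|Hn].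
    + apply Rle_trans with (2 := Rmax_l _ _); auto.
    + apply Rle_trans with (2 := Rmax_r _ _); auto.
Qed.

Lemma Clim_seq_Cmod_le (u : nat -> C) (l : C) (K : R) :
  (forall n, (Cmod (u n) <= K)%R) -> Clim_seq u l -> (Cmod l <= K)%R.
Proof.
  intros HK H; apply Clim_seq_Cmod in H.
  assert (Hle : Rbar_le (Cmod l) (K + 0)%R).
  { apply is_lim_seq_le with (u := fun _ => Cmod l)
      (v := fun n => (K + Cmod (u n - l))%R).
    - intros n; replace l with (u n + - (u n - l)) at 1 by ring.
      eapply Rle_trans; [apply Cmod_triangle|].
      rewrite Cmod_opp; specialize (HK n); lra.
    - apply is_lim_seq_const.
    - apply is_lim_seq_plus'; [apply is_lim_seq_const | exact H]. }
  simpl in Hle; lra.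
Qed.

Lemma Csum_O (u : nat -> C) : (sum_n u 0 : C) = u 0%nat.
Proof. exact (sum_O u). Qed.

Lemma Csum_S (u : nat -> C) (n : nat) : (sum_n u (S n) : C) = sum_n u n + u (S n).
Proof. exact (sum_Sn u n). Qed.

Lemma Csum_S_l (u : nat -> C) (n : nat) :
  (sum_n u (S n) : C) = u 0%nat + sum_n (fun k => u (S k)) n.
Proof.
  induction n as [|n IH]; [now rewrite Csum_S, !Csum_O|].
  rewrite Csum_S, IH, (Csum_S (fun k => u (S k)) n); ring.
Qed.

Lemma Csum_ext (u v : nat -> C) (n : nat) :
  (forall k, (k <= n)%nat -> u k = v k) -> (sum_n u n : C) = sum_n v n.
Proof. exact (sum_n_ext_loc u v n). Qed.

Lemma Csum_mult_l (c : C) (u : nat -> C) (n : nat) :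
  (sum_n (fun k => c * u k) n : C) = c * sum_n u n.
Proof. exact (sum_n_mult_l c u n). Qed.

Lemma Csum_plus (u v : nat -> C) (n : nat) :
  (sum_n (fun k => u k + v k) n : C) = sum_n u n + sum_n v n.
Proof. exact (sum_n_plus u v n). Qed.

Lemma Re_Csum (u : nat -> C) (n : nat) :
  Re (sum_n u n) = sum_n (fun k => Re (u k)) n.
Proof.
  induction n as [|n IH]; [now rewrite Csum_O, sum_O|].
  rewrite Csum_S, sum_Sn, <- IH; reflexivity.
Qed.

Lemma Im_Csum (u : nat -> C) (n : nat) :
  Im (sum_n u n) = sum_n (fun k => Im (u k)) n.
Proof.
  induction n as [|n IH]; [now rewrite Csum_O, sum_O|].
  rewrite Csum_S, sum_Sn, <- IH; reflexivity.
Qed.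

Lemma Cmod_Csum_le (u : nat -> C) (v : nat -> R) (n : nat) :
  (forall k, (Cmod (u k) <= v k)%R) -> (Cmod (sum_n u n) <= sum_n v n)%R.
Proof.
  intros H; induction n as [|n IH]; [rewrite Csum_O, sum_O; apply H|].
  rewrite Csum_S, sum_Sn.
  eapply Rle_trans; [apply Cmod_triangle|].
  apply Rplus_le_compat; auto.
Qed.

(** A ball of C is a product of balls of R around the two components, so both notions of convergence
    of the partial sums agree. *)
Lemma is_series_C (u : nat -> C) (l : C) :
  is_series (u : nat -> C_NormedModule) l <-> Clim_seq (fun n => sum_n u n) l.
Proof.
  split.
  - intros H; split; intros P [eps HP].
    + assert (HQ : locally (T := C_UniformSpace) l (fun z => P (Re z))).
      { exists eps; intros z [Hz _]; now apply HP. }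
      exact (H _ HQ).
    + assert (HQ : locally (T := C_UniformSpace) l (fun z => P (Im z))).
      { exists eps; intros z [_ Hz]; now apply HP. }
      exact (H _ HQ).
  - intros [H1 H2] P [eps HP].
    destruct (H1 (ball (Re l) eps) (locally_ball (Re l) eps)) as [N1 HN1].
    destruct (H2 (ball (Im l) eps) (locally_ball (Im l) eps)) as [N2 HN2].
    exists (max N1 N2); intros n Hn.
    apply HP; split; [apply HN1 | apply HN2]; lia.
Qed.

(** * Convergence criteria *)

Lemma ex_Clim_seq_abs (u : nat -> C) (v : nat -> R) :
  (forall n, (Cmod (u n) <= v n)%R) -> ex_series v ->
  exists l, Clim_seq (fun n => sum_n u n) l.
Proof.
  intros Hle Hv.
  assert (H1 : ex_series (fun n => Re (u n))).
  { apply (ex_series_le (V := R_CompleteNormedModule) _ v); auto; intros n.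
    eapply Rle_trans; [apply re_le_Cmod | auto]. }
  assert (H2 : ex_series (fun n => Im (u n))).
  { apply (ex_series_le (V := R_CompleteNormedModule) _ v); auto; intros n.
    eapply Rle_trans; [apply im_le_Cmod | auto]. }
  destruct H1 as [x Hx], H2 as [y Hy]; exists (x, y); split.
  - apply is_lim_seq_ext with (2 := Hx); intros n; symmetry; apply Re_Csum.
  - apply is_lim_seq_ext with (2 := Hy); intros n; symmetry; apply Im_Csum.
Qed.

(** Without its term at 0 the series has the terms 1/(n+2)^2 <= 1/((n+1)(n+2)) = 1/(n+1) - 1/(n+2),
    which telescope. *)
Lemma ex_series_inv_sq : ex_series (fun n => / (INR n + 1) ^ 2)%R.
Proof.
  apply ex_series_incr_1.
  apply (ex_series_le (V := R_CompleteNormedModule) _ (fun n => / (INR n + 1) - / (INR n + 2))%R).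
  { intros n; change (norm ?x) with (Rabs x).
    rewrite S_INR; generalize (pos_INR n); intros Hn.
    rewrite Rabs_pos_eq.
    - replace (/ (INR n + 1) - / (INR n + 2))%R
        with (/ ((INR n + 1) * (INR n + 2)))%R by (field; lra).
      apply Rinv_le_contravar; nra.
    - left; apply Rinv_0_lt_compat; nra. }
  exists 1%R.
  enough (H : is_lim_seq (sum_n (fun n => / (INR n + 1) - / (INR n + 2))%R) 1%R)
    by exact H.
  apply is_lim_seq_ext with (u := fun n => (1 - / (INR n + 2))%R).
  { intros n; induction n as [|n IH].
    - rewrite sum_O; simpl; field.
    - rewrite sum_Sn, <- IH, S_INR; change plus with Rplus.
      generalize (pos_INR n); intros; simpl.
      replace (INR n + 1 + 1)%R with (INR n + 2)%R by ring. ring. }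
  replace (Finite 1) with (Finite (1 - 0)) by (f_equal; ring).
  apply is_lim_seq_minus'; [apply is_lim_seq_const|].
  apply (is_lim_seq_inv _ p_infty); [|discriminate].
  eapply is_lim_seq_plus; [apply is_lim_seq_INR | apply is_lim_seq_const |].
  reflexivity.
Qed.

Lemma Rle_of_decr_from (u : nat -> R) (N : nat) :
  (forall n, (N <= n)%nat -> (u (S n) <= u n)%R) ->
  forall n, (N <= n)%nat -> (u n <= u N)%R.
Proof.
  intros H n Hn; induction Hn as [|n Hn IH]; [lra|].
  eapply Rle_trans; [apply H; exact Hn | exact IH].
Qed.

(* The increments bound makes [|u n| exp (K / n)] nonincreasing, so that [u]
   is bounded; its increments are then absolutely summable. *)
Lemma ex_Clim_seq_ratio (u : nat -> C) (K : R) (N : nat) :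
  (0 <= K)%R ->
  (forall n, (N <= n)%nat ->
    (Cmod (u (S n) - u n) <= K / (INR n + 1) ^ 2 * Cmod (u n))%R) ->
  exists l, Clim_seq u l.
Proof.
  intros HK0 HK.
  assert (HB : exists B, (0 <= B)%R /\
            forall n, (S N <= n)%nat -> (Cmod (u n) <= B)%R).
  { set (v := fun n : nat => (Cmod (u n) * exp (K / INR n))%R).
    exists (v (S N)); split.
    { apply Rmult_le_pos; [apply Cmod_ge_0 | left; apply exp_pos]. }
    intros n Hn.
    apply Rle_trans with (v n).
    { unfold v; rewrite <- (Rmult_1_r (Cmod (u n))) at 1.
      apply Rmult_le_compat_l; [apply Cmod_ge_0|].
      assert (0 <= K / INR n)%R.
      { apply Rmult_le_pos; auto.
        left; apply Rinv_0_lt_compat, lt_0_INR; lia. }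
      generalize (exp_ineq1_le (K / INR n)); lra. }
    apply Rle_of_decr_from; auto; clear n Hn; intros n Hn; unfold v.
    assert (Hn0 : (0 < INR n)%R) by (apply lt_0_INR; lia).
    assert (Hle : (Cmod (u (S n)) <= (1 + K / (INR n + 1) ^ 2) * Cmod (u n))%R).
    { replace (u (S n)) with (u n + (u (S n) - u n)) by ring.
      eapply Rle_trans; [apply Cmod_triangle|].
      generalize (HK n ltac:(lia)); lra. }
    (* The exponent of the weight drops by K/(n(n+1)) >= K/(n+1)^2; since 1 + x <= exp x, this
       absorbs the largest possible growth of the modulus. *)
    replace (K / INR n)%R with (K / INR (S n) + K / (INR n * (INR n + 1)))%R
      by (rewrite S_INR; field; lra).
    rewrite exp_plus.
    replace (Cmod (u n) * (exp (K / INR (S n)) *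
      exp (K / (INR n * (INR n + 1)))))%R with
      ((exp (K / (INR n * (INR n + 1))) * Cmod (u n)) * exp (K / INR (S n)))%R
      by ring.
    apply Rmult_le_compat_r; [left; apply exp_pos|].
    eapply Rle_trans; [exact Hle|].
    apply Rmult_le_compat_r; [apply Cmod_ge_0|].
    eapply Rle_trans; [|apply exp_ineq1_le].
    apply Rplus_le_compat_l, Rmult_le_compat_l; auto.
    apply Rinv_le_contravar; nra. }
  destruct HB as [B [HB0 HB]].
  (* The bound [B] holds only from [S N] on, where also n > 0. The earlier increments are replaced
     by 0, so that for n >= N the partial sum of [w] is u (n+1) - u (N+1). *)
  set (w := fun n => if le_lt_dec (S N) n then u (S n) - u n else RtoC 0).
  destruct (ex_Clim_seq_abs w
    (fun n => (K * B) * / (INR n + 1) ^ 2)%R) as [l Hl].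
  - intros n; generalize (pos_INR n); intros Hn0.
    assert (Hp : (0 < / (INR n + 1) ^ 2)%R)
      by (apply Rinv_0_lt_compat, pow_lt; lra).
    unfold w; destruct (le_lt_dec (S N) n) as [Hn|Hn].
    + eapply Rle_trans; [apply HK; lia|].
      specialize (HB n Hn).
      replace (K * B * / (INR n + 1) ^ 2)%R
        with (K / (INR n + 1) ^ 2 * B)%R by (unfold Rdiv; ring).
      apply Rmult_le_compat_l; auto.
      apply Rmult_le_pos; lra.
    + rewrite Cmod_0; apply Rmult_le_pos; [nra | lra].
  - exact (ex_series_scal_l (K * B)%R _ ex_series_inv_sq).
  - exists (u (S N) + l).
    apply Clim_seq_incr_1.
    apply Clim_seq_ext_loc with (2 := Clim_seq_plus _ _ _ _ (Clim_seq_const _) Hl).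
    exists N; intros n Hn; induction Hn as [|n Hn IH].
    + assert (Hz : forall k, (k <= N)%nat -> (sum_n w k : C) = 0).
      { induction k as [|k IHk]; intros Hk.
        - rewrite Csum_O; unfold w.
          destruct (le_lt_dec (S N) 0); [lia | auto].
        - rewrite Csum_S, IHk by lia; unfold w.
          destruct (le_lt_dec (S N) (S k)); [lia | ring]. }
      rewrite Hz by lia; ring.
    + rewrite Csum_S, Cplus_assoc, IH; unfold w.
      destruct (le_lt_dec (S N) (S n)); [ring | lia].
Qed.

(** * The reciprocal Gamma function *)

Definition Cexp (w : C) : C := exp (Re w) * (cos (Im w), sin (Im w)).

Lemma Cexp_plus (v w : C) : Cexp (v + w) = Cexp v * Cexp w.
Proof.
  unfold Cexp; rewrite re_plus, im_plus, exp_plus, cos_plus, sin_plus.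
  apply C_ext; simpl; ring.
Qed.

Lemma Cexp_0 : Cexp 0 = 1.
Proof.
  unfold Cexp; simpl; rewrite exp_0, cos_0, sin_0; apply C_ext; simpl; ring.
Qed.

Lemma Cexp_opp_l (w : C) : Cexp (- w) * Cexp w = 1.
Proof. rewrite <- Cexp_plus, Cplus_comm, Cplus_opp_r; apply Cexp_0. Qed.

Lemma Cexp_nz (w : C) : Cexp w <> 0.
Proof.
  intros H; apply C1_nz; rewrite <- (Cexp_opp_l w), H; ring.
Qed.

Lemma Cexp_opp (w : C) : Cexp (- w) = / Cexp w.
Proof.
  rewrite <- (Cmult_1_r (/ Cexp w)), <- (Cexp_opp_l w).
  field; apply Cexp_nz.
Qed.

Lemma Cmod_Cexp (w : C) : Cmod (Cexp w) = exp (Re w).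
Proof.
  unfold Cexp; rewrite Cmod_mult, Cmod_R, Rabs_pos_eq by (left; apply exp_pos).
  rewrite <- (Rmult_1_r (exp (Re w))) at 2; f_equal.
  unfold Cmod; simpl fst; simpl snd.
  replace (cos (Im w) ^ 2 + sin (Im w) ^ 2)%R with 1%R; [apply sqrt_1|].
  generalize (sin2_cos2 (Im w)); unfold Rsqr; intros; lra.
Qed.

Lemma nat_cpow_Cexp (n : nat) (s : C) : nat_cpow n s = Cexp (s * ln (INR n)).
Proof.
  unfold nat_cpow, Cexp; rewrite re_scal_r, im_scal_r; reflexivity.
Qed.

Lemma fact_C_nz (n : nat) : RtoC (INR (fact n)) <> 0.
Proof. intros H; apply RtoC_inj in H; now apply (INR_fact_neq_0 n). Qed.

Lemma fact_C_S (n : nat) :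
  RtoC (INR (fact (S n))) = (RtoC (INR n) + 1) * INR (fact n).
Proof. now rewrite fact_simpl, mult_INR, S_INR, RtoC_mult, RtoC_plus. Qed.

Lemma INR_C_S (n : nat) : RtoC (INR (S n)) = RtoC (INR n) + 1.
Proof. now rewrite S_INR, RtoC_plus. Qed.

Lemma INR_C_add (n k : nat) : RtoC (INR (n + k)) = RtoC (INR n) + INR k.
Proof. now rewrite plus_INR, RtoC_plus. Qed.

Lemma INR_C_S_nz (n : nat) : RtoC (INR n) + 1 <> 0.
Proof.
  rewrite <- INR_C_S; intros H; apply RtoC_inj in H.
  now apply (not_0_INR (S n)).
Qed.

Lemma poch_nz (z : C) (n : nat) : ~ nonpos_int z -> poch z n <> 0.
Proof.
  intros Hz; induction n as [|n IH]; [apply C1_nz|]; simpl.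
  apply Cmult_neq_0; auto; intros H; apply Hz; exists n.
  rewrite <- (Cplus_0_l (- _)), <- H; ring.
Qed.

Lemma poch_add (z : C) (n k : nat) :
  poch z (n + k) = poch z n * poch (z + INR n) k.
Proof.
  induction k as [|k IH]; simpl.
  - rewrite Nat.add_0_r; ring.
  - rewrite Nat.add_succ_r; simpl; rewrite IH, INR_C_add; ring.
Qed.

Lemma poch_S_l (z : C) (n : nat) : poch z (S n) = z * poch (z + 1) n.
Proof.
  change (S n) with (1 + n)%nat; rewrite poch_add; simpl; ring.
Qed.

Lemma poch_1 (n : nat) : poch 1 n = INR (fact n).
Proof.
  induction n as [|n IH]; [reflexivity|].
  simpl poch; rewrite IH, fact_C_S; ring.
Qed.

(** The factors on the left are those of (z)_n in reverse order and with opposite signs. *)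
Lemma poch_reflect (z : C) (n : nat) :
  poch (1 - z - INR n) n = (- (1)) ^ n * poch z n.
Proof.
  induction n as [|n IH]; [simpl; ring|].
  rewrite poch_S_l.
  replace (1 - z - INR (S n) + 1) with (1 - z - INR n)
    by (rewrite INR_C_S; ring).
  rewrite IH, INR_C_S; simpl; ring.
Qed.

Lemma nonpos_int_add (z : C) (n : nat) : nonpos_int (z + INR n) -> nonpos_int z.
Proof.
  intros [k Hk]; exists (k + n)%nat.
  rewrite INR_C_add; replace z with (z + INR n - INR n) by ring.
  rewrite Hk; ring.
Qed.

Lemma Re_pos_not_nonpos_int (z : C) : (0 < Re z)%R -> ~ nonpos_int z.
Proof.
  intros H [n ->]; simpl in H; generalize (pos_INR n); lra.
Qed.

(** The inverted approximant has a denominator that never vanishes, not even at n = 0, where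
    [nat_cpow] is still an exponential. Its limit therefore exists for every z, poles of Gamma
    included. *)
Definition rGamma_approx (z : C) (n : nat) : C :=
  poch z n / (INR (fact n) * nat_cpow n (z - 1)).

Lemma nat_cpow_nz (n : nat) (s : C) : nat_cpow n s <> 0.
Proof. rewrite nat_cpow_Cexp; apply Cexp_nz. Qed.

(* The derivative in [h] is [- s (1 + s) h / (1 - h) exp (s log (1 - h))], and
   [p + q i = s (1 + s)]. *)
Lemma Euler_factor_bound (s : C) : exists K, (0 <= K)%R /\
  forall h, (0 <= h <= / 2)%R ->
    (Cmod ((1 + s * h) * Cexp (s * ln (1 - h)) - 1) <= K * h ^ 2)%R.
Proof.
  destruct s as [x y].
  set (E := fun h => exp (x * ln (1 - h))).
  set (c := fun h => cos (y * ln (1 - h))).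
  set (d := fun h => sin (y * ln (1 - h))).
  set (p := (x + x * x - y * y)%R); set (q := (y + 2 * x * y)%R).
  (* For 0 <= h <= 1/2 the factor 2 bounds 1/(1-h), and exp |x| bounds [E h] because |ln (1-h)| <=
     ln 2 < 1. *)
  set (K := ((Rabs p + Rabs q) * 2 * exp (Rabs x))%R).
  assert (HK : (0 <= K)%R).
  { unfold K; generalize (Rabs_pos p) (Rabs_pos q) (exp_pos (Rabs x)); intros.
    apply Rmult_le_pos; lra. }
  assert (Hln : forall h, (0 <= h <= / 2)%R -> (-1 <= ln (1 - h) <= 0)%R).
  { intros h Hh; split.
    - apply Rle_trans with (- ln 2)%R; [generalize ln_lt_2; intros|].
      + assert (ln 2 < 1)%R; [|lra].
        rewrite <- (ln_exp 1); apply ln_increasing; [lra|].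
        generalize (exp_ineq1 1 ltac:(lra)); lra.
      + rewrite <- ln_Rinv by lra; apply ln_le; lra.
    - rewrite <- ln_1; apply ln_le; lra. }
  assert (HB : forall h u v, (0 <= h <= / 2)%R ->
    (Rabs u <= 1)%R -> (Rabs v <= 1)%R ->
    (Rabs (- h / (1 - h) * E h * (p * u + q * v)) <= K * h)%R).
  { intros h u v Hh Hu Hv.
    assert (HE : (0 < E h <= exp (Rabs x))%R).
    { split; [apply exp_pos|]; unfold E.
      assert (H : (x * ln (1 - h) <= Rabs x)%R).
      { specialize (Hln h Hh).
        apply Rle_trans with (1 := Rle_abs _).
        rewrite Rabs_mult, (Rabs_left1 (ln (1 - h))) by lra.
        generalize (Rabs_pos x); nra. }
      destruct H as [H|H]; [left; now apply exp_increasing | rewrite H; lra]. }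
    rewrite !Rabs_mult.
    assert (H1 : (Rabs (- h / (1 - h)) <= 2 * h)%R).
    { unfold Rdiv; rewrite Rabs_mult, Rabs_Ropp, Rabs_pos_eq by lra.
      rewrite Rabs_pos_eq by (left; apply Rinv_0_lt_compat; lra).
      rewrite Rmult_comm; apply Rmult_le_compat_r; [lra|].
      replace 2%R with (/ / 2)%R by field.
      apply Rinv_le_contravar; lra. }
    assert (H2 : (Rabs (p * u + q * v) <= Rabs p + Rabs q)%R).
    { eapply Rle_trans; [apply Rabs_triang|]; rewrite !Rabs_mult.
      generalize (Rabs_pos p) (Rabs_pos q); intros; nra. }
    rewrite (Rabs_pos_eq (E h)) by lra.
    unfold K; replace ((Rabs p + Rabs q) * 2 * exp (Rabs x) * h)%R
      with ((2 * h) * exp (Rabs x) * (Rabs p + Rabs q))%R by ring.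
    apply Rmult_le_compat; auto using Rabs_pos.
    - apply Rmult_le_pos; [apply Rabs_pos | lra].
    - apply Rmult_le_compat; try lra; apply Rabs_pos. }
  (* The mean value theorem is real, so it is applied to each component. The real part of (p + q
     i)(c + d i) is p c - q d and its imaginary part p d + q c, both of the form p u + q v with |u|,
     |v| <= 1. A derivative of size K h gives an increment of size K h^2. *)
  assert (Hmvt : forall (f : R -> R) (u v : R -> R),
    (forall h, (0 <= h <= / 2)%R ->
      is_derive f h (- h / (1 - h) * E h * (p * u h + q * v h))%R) ->
    (forall h, (Rabs (u h) <= 1)%R) -> (forall h, (Rabs (v h) <= 1)%R) ->
    forall h, (0 <= h <= / 2)%R -> (Rabs (f h - f 0%R) <= K * h ^ 2)%R).
  { intros f u v Hf Hu Hv h Hh.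
    destruct (MVT_abs f (fun h => - h / (1 - h) * E h * (p * u h + q * v h))%R
      0 h) as [t [Ht1 Ht2]].
    - intros t; rewrite Rmin_left, Rmax_right by lra; intros Ht.
      apply is_derive_Reals, Hf; lra.
    - rewrite Rmin_left, Rmax_right in Ht2 by lra.
      rewrite Ht1, Rminus_0_r, (Rabs_pos_eq h) by lra.
      replace (K * h ^ 2)%R with (K * h * h)%R by ring.
      apply Rmult_le_compat_r; [lra|].
      eapply Rle_trans; [apply HB; auto; lra|].
      apply Rmult_le_compat_l; lra. }
  assert (Hbc : forall t, (Rabs (cos t) <= 1)%R)
    by (intros t; apply Rabs_le; destruct (COS_bound t); lra).
  assert (Hbs : forall t, (Rabs (sin t) <= 1)%R)
    by (intros t; apply Rabs_le; destruct (SIN_bound t); lra).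
  set (f1 := fun h => (E h * ((1 + x * h) * c h - y * h * d h))%R).
  set (f2 := fun h => (E h * ((1 + x * h) * d h + y * h * c h))%R).
  exists (K + K)%R; split; [lra|]; intros h Hh.
  eapply Rle_trans; [apply Cmod_le_Re_Im|].
  rewrite Rmult_plus_distr_r.
  apply Rplus_le_compat.
  - replace (Re _) with (f1 h - f1 0)%R.
    + apply Hmvt with (u := c) (v := fun h => (- d h)%R); auto.
      * intros t Ht; unfold f1, f2, E, c, d, p, q; auto_derive; [lra|]; unfold Rminus.
        field; lra.
      * intros t; apply Hbc.
      * intros t; rewrite Rabs_Ropp; apply Hbs.
    + unfold f1, f2, Cexp, E, c, d; simpl.
      rewrite Rminus_0_r, ln_1, !Rmult_0_r, cos_0, sin_0, exp_0.
      replace (x * ln (1 - h) - 0)%R with (x * ln (1 - h))%R by ring.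
      replace (0 + y * ln (1 - h))%R with (y * ln (1 - h))%R by ring.
      ring.
  - replace (Im _) with (f2 h - f2 0)%R.
    + apply Hmvt with (u := d) (v := c); auto.
      * intros t Ht; unfold f1, f2, E, c, d, p, q; auto_derive; [lra|]; unfold Rminus.
        field; lra.
      * intros t; apply Hbs.
      * intros t; apply Hbc.
    + unfold f1, f2, Cexp, E, c, d; simpl.
      rewrite Rminus_0_r, ln_1, !Rmult_0_r, cos_0, sin_0, exp_0.
      replace (x * ln (1 - h) - 0)%R with (x * ln (1 - h))%R by ring.
      replace (0 + y * ln (1 - h))%R with (y * ln (1 - h))%R by ring.
      ring.
Qed.

(** The quotient of the Pochhammer symbols over the factorials is (z+n)/(n+1) = 1 + (z-1)/(n+1),
    that of the powers is (n/(n+1))^(z-1). This is the expression of [Euler_factor_bound] with s = z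
    - 1 and h = 1/(n+1); n = 0 is excluded because of ln n. *)
Lemma rGamma_approx_S (z : C) (n : nat) : (1 <= n)%nat ->
  rGamma_approx z (S n) = rGamma_approx z n *
    ((1 + (z - 1) * (/ (INR n + 1))%R) *
     Cexp ((z - 1) * ln (1 - / (INR n + 1)))).
Proof.
  intros Hn; unfold rGamma_approx.
  assert (Hp : (0 < INR n)%R) by (apply lt_0_INR; lia).
  assert (Hc : Cexp ((z - 1) * ln (1 - / (INR n + 1))) =
               nat_cpow n (z - 1) / nat_cpow (S n) (z - 1)).
  { rewrite !nat_cpow_Cexp; unfold Cdiv; rewrite <- Cexp_opp, <- Cexp_plus.
    f_equal.
    replace (1 - / (INR n + 1))%R with (INR n * / INR (S n))%R
      by (rewrite S_INR; field; lra).
    rewrite ln_mult, ln_Rinv, RtoC_plus, RtoC_opp; auto;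
      try (rewrite S_INR; lra).
    - ring.
    - apply Rinv_0_lt_compat; rewrite S_INR; lra. }
  rewrite Hc, fact_C_S, RtoC_inv, RtoC_plus by lra; simpl poch.
  generalize (fact_C_nz n) (INR_C_S_nz n) (nat_cpow_nz n (z - 1))
    (nat_cpow_nz (S n) (z - 1)); intros.
  field; auto.
Qed.

Lemma rGamma_approx_ratio (z : C) : exists K, (0 <= K)%R /\
  forall n, (1 <= n)%nat ->
    (Cmod (rGamma_approx z (S n) - rGamma_approx z n) <=
     K / (INR n + 1) ^ 2 * Cmod (rGamma_approx z n))%R.
Proof.
  destruct (Euler_factor_bound (z - 1)) as [K [HK0 HK]].
  exists K; split; auto; intros n Hn.
  rewrite rGamma_approx_S by auto.
  set (w := _ * Cexp _).
  replace (rGamma_approx z n * w - rGamma_approx z n)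
    with ((w - 1) * rGamma_approx z n) by ring.
  rewrite Cmod_mult; apply Rmult_le_compat_r; [apply Cmod_ge_0|].
  unfold Rdiv; rewrite <- pow_inv; apply HK.
  assert (H : (1 <= INR n)%R) by (apply (le_INR 1); auto).
  split; [left; apply Rinv_0_lt_compat; lra | apply Rinv_le_contravar; lra].
Qed.

Definition rGamma (z : C) : C :=
  (real (Lim_seq (fun n => Re (rGamma_approx z n))),
   real (Lim_seq (fun n => Im (rGamma_approx z n)))).

Lemma rGamma_lim (z : C) : Clim_seq (rGamma_approx z) (rGamma z).
Proof.
  destruct (rGamma_approx_ratio z) as [K [HK0 HK]].
  destruct (ex_Clim_seq_ratio _ K 1 HK0 HK) as [l [H1 H2]].
  unfold rGamma.
  rewrite (is_lim_seq_unique _ _ H1), (is_lim_seq_unique _ _ H2).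
  split; auto.
Qed.

Lemma Gamma_approx_inv (z : C) (n : nat) : poch z n <> 0 ->
  Gamma_approx z n = / rGamma_approx z n.
Proof.
  intros Hz; unfold Gamma_approx, rGamma_approx.
  generalize (fact_C_nz n) (nat_cpow_nz n (z - 1)); intros.
  field; auto.
Qed.

Lemma Gamma_unique (z l : C) : Clim_seq (Gamma_approx z) l -> Gamma z = l.
Proof.
  intros [H1 H2]; unfold Gamma.
  rewrite (is_lim_seq_unique _ _ H1), (is_lim_seq_unique _ _ H2).
  destruct l; reflexivity.
Qed.

Lemma rGamma_approx_nz (z : C) (n : nat) :
  ~ nonpos_int z -> rGamma_approx z n <> 0.
Proof.
  intros Hz; unfold rGamma_approx, Cdiv.
  generalize (fact_C_nz n) (nat_cpow_nz n (z - 1)) (poch_nz z n Hz); intros.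
  apply Cmult_neq_0; auto; intros H2; apply C1_nz.
  rewrite <- (Cinv_r (INR (fact n) * nat_cpow n (z - 1)))
    by now apply Cmult_neq_0.
  rewrite H2; ring.
Qed.

(* The reciprocals of the approximants satisfy the same kind of ratio
   estimate, so they converge too and neither limit can vanish. *)
Lemma Gamma_lim (z : C) :
  ~ nonpos_int z -> Clim_seq (Gamma_approx z) (Gamma z).
Proof.
  intros Hz.
  assert (Hr := fun n => rGamma_approx_nz z n Hz).
  destruct (rGamma_approx_ratio z) as [K [HK0 HK]].
  (* Beyond 2 K the relative increment is at most 1/2, hence |u| <= 2 |v| for consecutive
     approximants u, v. This turns the bound on v - u into one on 1/v - 1/u, with constant 2 K. *)
  destruct (INR_unbounded (2 * K)) as [N HN].
  assert (Hex : exists l, Clim_seq (fun n => / rGamma_approx z n) l).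
  { apply ex_Clim_seq_ratio with (2 * K)%R (S N); [lra|].
    intros n Hn; specialize (HK n ltac:(lia)).
    set (u := rGamma_approx z n) in *; set (v := rGamma_approx z (S n)) in *.
    assert (Hu : u <> 0) by apply Hr; assert (Hv : v <> 0) by apply Hr.
    assert (Hu' := proj1 (Cmod_gt_0 u) Hu).
    assert (Hv' := proj1 (Cmod_gt_0 v) Hv).
    replace (/ v - / u) with (- (v - u) / (u * v)) by (field; auto).
    rewrite Cmod_div, Cmod_opp, Cmod_mult, Cmod_inv
      by (auto using Cmult_neq_0).
    assert (Hq : (K / (INR n + 1) ^ 2 <= / 2)%R).
    { apply le_INR in Hn; rewrite S_INR in Hn; generalize (pos_INR N); intros.
      apply Rle_div_l; [apply Rlt_gt, pow_lt; lra | nra]. }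
    assert (H2 : (Cmod u <= 2 * Cmod v)%R).
    { assert (H3 : (Cmod u <= Cmod v + Cmod (v - u))%R).
      { replace u with (v + - (v - u)) at 1 by ring.
        eapply Rle_trans; [apply Cmod_triangle|]; rewrite Cmod_opp; lra. }
      nra. }
    assert (Hs : (0 <= K / (INR n + 1) ^ 2)%R).
    { apply Rmult_le_pos; auto; left; apply Rinv_0_lt_compat, pow_lt.
      generalize (pos_INR n); lra. }
    replace (2 * K / (INR n + 1) ^ 2 * / Cmod u)%R with
      ((K / (INR n + 1) ^ 2 * (2 * Cmod v)) / (Cmod u * Cmod v))%R
      by (field; generalize (pos_INR n); lra).
    apply Rmult_le_compat_r.
    - left; apply Rinv_0_lt_compat; nra.
    - eapply Rle_trans; [exact HK|]; now apply Rmult_le_compat_l. }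
  destruct Hex as [l Hl].
  assert (H : Clim_seq (Gamma_approx z) l).
  { apply Clim_seq_ext with (2 := Hl); intros n.
    symmetry; now apply Gamma_approx_inv, poch_nz. }
  now rewrite (Gamma_unique z l H).
Qed.

Lemma Gamma_mult_rGamma (z : C) : ~ nonpos_int z -> Gamma z * rGamma z = 1.
Proof.
  intros Hz.
  apply Clim_seq_unique with (fun n => Gamma_approx z n * rGamma_approx z n).
  - apply Clim_seq_mult; [now apply Gamma_lim | apply rGamma_lim].
  - apply Clim_seq_ext with (fun _ => RtoC 1); [|apply Clim_seq_const].
    intros n; rewrite Gamma_approx_inv by now apply poch_nz.
    rewrite Cinv_l; auto using rGamma_approx_nz.
Qed.

Lemma rGamma_nz (z : C) : ~ nonpos_int z -> rGamma z <> 0.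
Proof.
  intros Hz H; apply C1_nz.
  rewrite <- (Gamma_mult_rGamma z Hz), H; ring.
Qed.

Lemma poch_nonpos_int (n k : nat) : (n < k)%nat -> poch (- INR n) k = 0.
Proof.
  intros H; replace k with (S n + (k - S n))%nat by lia.
  rewrite poch_add; simpl; ring.
Qed.

(** Both components of the inverse have numerator 0, whatever the real inverse of 0 is. *)
Lemma Cinv_0 : / RtoC 0 = 0.
Proof.
  unfold Cinv; simpl; apply C_ext; simpl; unfold Rdiv; rewrite ?Ropp_0; ring.
Qed.

(* Also at the poles, where both sides are 0. *)
Lemma Gamma_rGamma (z : C) : Gamma z = / rGamma z.
Proof.
  destruct (classic (nonpos_int z)) as [[n Hn]|Hz].
  - assert (H0 : eventually (fun k => RtoC 0 = poch z k)).
    { exists (S n); intros k Hk; rewrite Hn; symmetry.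
      apply poch_nonpos_int; lia. }
    assert (Hr : rGamma z = 0).
    { apply Clim_seq_unique with (1 := rGamma_lim z).
      apply Clim_seq_ext_loc with (2 := Clim_seq_const 0).
      destruct H0 as [N H0]; exists N; intros k Hk.
      unfold rGamma_approx; rewrite <- H0 by auto; unfold Cdiv; ring. }
    rewrite Hr, Cinv_0; apply Gamma_unique.
    apply Clim_seq_ext_loc with (2 := Clim_seq_const 0).
    destruct H0 as [N H0]; exists N; intros k Hk.
    unfold Gamma_approx, Cdiv; rewrite <- H0, Cinv_0 by auto; ring.
  - rewrite <- (Cmult_1_r (Gamma z)), <- (Cinv_r (rGamma z)), Cmult_assoc,
      Gamma_mult_rGamma, Cmult_1_l by auto using rGamma_nz.
    reflexivity.
Qed.

(** From z (z+1)_n = (z)_n (z+n), the approximant at z + 1 multiplied by z is the one at z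
    multiplied by 1 + z/n, a factor tending to 1. *)
Lemma rGamma_step (z : C) : rGamma z = z * rGamma (z + 1).
Proof.
  apply Clim_seq_unique with
    (fun n => rGamma_approx z n * (1 + z * (/ INR n)%R)).
  - replace (rGamma z) with (rGamma z * (1 + z * 0)) by ring.
    apply Clim_seq_mult; [apply rGamma_lim|].
    apply Clim_seq_plus; [apply Clim_seq_const|].
    apply Clim_seq_mult; [apply Clim_seq_const|].
    split; simpl; [|apply is_lim_seq_const].
    apply (is_lim_seq_inv _ p_infty); [apply is_lim_seq_INR | discriminate].
  - apply Clim_seq_ext_loc with (fun n => z * rGamma_approx (z + 1) n).
    + exists 1%nat; intros n Hn; unfold rGamma_approx.
      assert (Hp : (0 < INR n)%R) by (apply lt_0_INR; lia).
      assert (Hp' : RtoC (INR n) <> 0) by (intros H; apply RtoC_inj in H; lra).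
      assert (Hc : nat_cpow n (z + 1 - 1) = nat_cpow n (z - 1) * INR n).
      { rewrite !nat_cpow_Cexp.
        replace ((z + 1 - 1) * ln (INR n))
          with ((z - 1) * ln (INR n) + ln (INR n)) by ring.
        rewrite Cexp_plus; f_equal; unfold Cexp; simpl.
        rewrite exp_ln, cos_0, sin_0 by auto.
        apply C_ext; simpl; ring. }
      assert (Hq : z * poch (z + 1) n = poch z n * (z + INR n)).
      { rewrite <- poch_S_l; reflexivity. }
      unfold Cdiv; rewrite Cmult_assoc, Hq, Hc, RtoC_inv by lra.
      generalize (fact_C_nz n) (nat_cpow_nz n (z - 1)); intros.
      field; auto.
    + apply Clim_seq_mult; [apply Clim_seq_const | apply rGamma_lim].
Qed.

Lemma rGamma_poch (z : C) (n : nat) : rGamma z = poch z n * rGamma (z + INR n).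
Proof.
  induction n as [|n IH].
  - simpl; rewrite Cplus_0_r; ring.
  - rewrite IH, (rGamma_step (z + INR n)), INR_C_S, Cplus_assoc; simpl; ring.
Qed.

Lemma rGamma_1 : rGamma 1 = 1.
Proof.
  apply Clim_seq_unique with (1 := rGamma_lim 1).
  apply Clim_seq_ext with (2 := Clim_seq_const 1); intros n.
  unfold rGamma_approx; rewrite poch_1, nat_cpow_Cexp.
  replace ((1 - 1) * ln (INR n)) with (RtoC 0) by ring.
  rewrite Cexp_0; generalize (fact_C_nz n); intros; field; auto.
Qed.

Lemma rGamma_fact (n : nat) : INR (fact n) * rGamma (INR (S n)) = 1.
Proof.
  rewrite <- rGamma_1, (rGamma_poch 1 n), poch_1, INR_C_S, Cplus_comm.
  reflexivity.
Qed.

(** * Gauss's summation theorem *)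

Definition hyp (a b c : C) (n : nat) : C :=
  poch a n * poch b n / (poch c n * INR (fact n)).

Lemma hyp_0 (a b c : C) : hyp a b c 0 = 1.
Proof. unfold hyp; simpl; field; apply C1_nz. Qed.

Lemma hyp_S (a b c : C) (n : nat) : ~ nonpos_int c ->
  (c + INR n) * (INR n + 1) * hyp a b c (S n) =
  (a + INR n) * (b + INR n) * hyp a b c n.
Proof.
  intros Hc; unfold hyp; rewrite fact_C_S.
  generalize (poch_nz c n Hc) (poch_nz c (S n) Hc) (fact_C_nz n) (INR_C_S_nz n).
  simpl poch; intros H1 H2 H3 H4.
  assert (c + INR n <> 0) by (intros H; apply H2; rewrite H; ring).
  field; auto.
Qed.

Lemma hyp_succ_bot (a b c : C) (n : nat) : ~ nonpos_int c ->
  c * hyp a b c n = (c + INR n) * hyp a b (c + 1) n.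
Proof.
  intros Hc; unfold hyp.
  assert (Hc1 : ~ nonpos_int (c + 1)).
  { intros H; now apply Hc, (nonpos_int_add c 1). }
  generalize (poch_nz c n Hc) (poch_nz (c + 1) n Hc1) (fact_C_nz n).
  generalize (poch_S_l c n); simpl; intros H0 H1 H2 H3.
  apply (f_equal (fun t => poch a n * poch b n * t / (poch c n *
    poch (c + 1) n * INR (fact n)))) in H0.
  replace (c * _) with (poch a n * poch b n * (c * poch (c + 1) n) /
    (poch c n * poch (c + 1) n * INR (fact n))) by (field; auto).
  rewrite <- H0; field; auto.
Qed.

(** The term is exactly the product of the n-th approximants of 1/Gamma(a), 1/Gamma(b) and Gamma(c)
    with n^(a+b-c-1); the approximants converge and are therefore bounded. *)
Lemma hyp_bound (a b c : C) : ~ nonpos_int c ->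
  exists K, (0 < K)%R /\ forall n, (1 <= n)%nat ->
    (Cmod (hyp a b c n) <= K * exp (Re (a + b - c - 1) * ln (INR n)))%R.
Proof.
  intros Hc.
  destruct (Clim_seq_bounded _ _ (rGamma_lim a)) as [K1 [H1 HK1]].
  destruct (Clim_seq_bounded _ _ (rGamma_lim b)) as [K2 [H2 HK2]].
  destruct (Clim_seq_bounded _ _ (Gamma_lim c Hc)) as [K3 [H3 HK3]].
  exists (K1 * K2 * K3)%R; split; [repeat apply Rmult_lt_0_compat; auto|].
  intros n Hn.
  replace (hyp a b c n) with (rGamma_approx a n * rGamma_approx b n *
    Gamma_approx c n * nat_cpow n (a + b - c - 1)).
  - rewrite !Cmod_mult, (nat_cpow_Cexp n (a + b - c - 1)), Cmod_Cexp, re_scal_r.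
    apply Rmult_le_compat_r; [left; apply exp_pos|].
    repeat (apply Rmult_le_compat; auto using Cmod_ge_0, Rmult_le_pos).
  - unfold hyp, rGamma_approx, Gamma_approx.
    replace (nat_cpow n (a + b - c - 1)) with
      (nat_cpow n (a - 1) * nat_cpow n (b - 1) / nat_cpow n (c - 1)).
    + generalize (fact_C_nz n) (nat_cpow_nz n (a - 1)) (nat_cpow_nz n (b - 1))
        (nat_cpow_nz n (c - 1)) (poch_nz c n Hc); intros.
      field; auto.
    + rewrite !nat_cpow_Cexp; unfold Cdiv.
      rewrite <- Cexp_opp, <- !Cexp_plus; f_equal; ring.
Qed.

Lemma is_lim_seq_npow_neg (x : R) : (x < 0)%R ->
  is_lim_seq (fun n => exp (x * ln (INR n))) 0%R.
Proof.
  intros Hx.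
  apply (is_lim_comp_seq exp _ m_infty 0%R).
  - apply is_lim_exp_m.
  - exists 0%nat; intros n _. discriminate.
  - replace m_infty with (Rbar_mult x p_infty).
    + apply is_lim_seq_scal_l.
      apply (is_lim_comp_seq ln _ p_infty p_infty).
      * apply is_lim_ln_p.
      * exists 0%nat; intros n _; discriminate.
      * apply is_lim_seq_INR.
    + simpl; destruct (Rle_dec 0 x) as [H|H]; [exfalso; lra | reflexivity].
Qed.

(** This is the boundary term left over by the telescoping in the contiguous relation; by
    [hyp_bound] it is O(n^(-Re (c-a-b))). *)
Lemma hyp_boundary (a b c : C) : ~ nonpos_int c -> (0 < Re (c - a - b))%R ->
  Clim_seq (fun n => INR n * hyp a b c n) 0.
Proof.
  intros Hc H; destruct (hyp_bound a b c Hc) as [K [HK0 HK]].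
  apply Clim_seq_squeeze with
    (fun n => (K * exp (- Re (c - a - b) * ln (INR n)))%R).
  - exists 1%nat; intros n Hn.
    assert (Hp : (0 < INR n)%R) by (apply lt_0_INR; lia).
    replace (INR n * hyp a b c n - 0) with (INR n * hyp a b c n) by ring.
    rewrite Cmod_mult, Cmod_R, Rabs_pos_eq by lra.
    apply Rle_trans with
      (INR n * (K * exp (Re (a + b - c - 1) * ln (INR n))))%R.
    + apply Rmult_le_compat_l; [lra | auto].
    + rewrite <- (exp_ln (INR n)) at 1 by auto.
      replace (exp (ln (INR n)) * (K * exp (Re (a + b - c - 1) * ln (INR n))))%R
        with (K * exp (ln (INR n) + Re (a + b - c - 1) * ln (INR n)))%R
        by (rewrite exp_plus; ring).
      right; do 2 f_equal; unfold Re; simpl; ring.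
  - replace (Finite 0) with (Rbar_mult K 0%R) by (simpl; f_equal; ring).
    apply is_lim_seq_scal_l, is_lim_seq_npow_neg; lra.
Qed.

(** Under this stronger condition the terms are O(1/n^2). The remaining range of c - a - b is
    reached in [ex_hyp]. *)
Lemma hyp_abs_summable (a b c : C) :
  ~ nonpos_int c -> (1 <= Re (c - a - b))%R ->
  ex_series (fun n => Cmod (hyp a b c n)).
Proof.
  intros Hc H; destruct (hyp_bound a b c Hc) as [K [HK0 HK]].
  apply ex_series_incr_1.
  apply (ex_series_le (V := R_CompleteNormedModule) _
    (fun n => K * / (INR n + 1) ^ 2)%R).
  - intros n; change (norm ?x) with (Rabs x).
    rewrite Rabs_pos_eq by apply Cmod_ge_0.
    eapply Rle_trans; [apply HK; lia|].
    apply Rmult_le_compat_l; [lra|].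
    rewrite S_INR; assert (Hn := pos_INR n).
    replace (/ (INR n + 1) ^ 2)%R with (exp (- 2 * ln (INR n + 1))).
    + assert (Hln : (0 <= ln (INR n + 1))%R).
      { rewrite <- ln_1; apply ln_le; lra. }
      assert (Hle : (Re (a + b - c - 1) * ln (INR n + 1) <=
                     - 2 * ln (INR n + 1))%R).
      { apply Rmult_le_compat_r; auto.
        revert H; unfold Re; simpl; lra. }
      destruct Hle as [Hle|Hle]; [left; now apply exp_increasing|].
      rewrite Hle; lra.
    + replace (- 2 * ln (INR n + 1))%R
        with (- ln (INR n + 1) + - ln (INR n + 1))%R by ring.
      rewrite exp_plus, exp_Ropp, exp_ln by lra; field; lra.
  - exact (ex_series_scal_l K _ ex_series_inv_sq).
Qed.

Definition is_hyp (a b c v : C) : Prop :=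
  Clim_seq (fun n => sum_n (hyp a b c) n) v.

(* The telescoping
   [(c - a - b) t_n - (c - a) (c - b) / c * s_n = n t_n - (n + 1) t_(n+1)],
   with [t], [s] the terms for the bottom parameters [c], [c + 1]. *)
Lemma hyp_contiguous (a b c : C) (n : nat) : ~ nonpos_int c ->
  c * (c - a - b) * sum_n (hyp a b c) n =
  (c - a) * (c - b) * sum_n (hyp a b (c + 1)) n -
  c * (INR (S n) * hyp a b c (S n)).
Proof.
  intros Hc.
  assert (Hn : forall k, c + INR k <> 0).
  { intros k H; apply Hc; exists k.
    replace c with (c + INR k - INR k) by ring; rewrite H; ring. }
  assert (Ht : forall k, c * (c - a - b) * hyp a b c k =
    (c - a) * (c - b) * hyp a b (c + 1) k +
    c * (INR k * hyp a b c k) - c * (INR (S k) * hyp a b c (S k))).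
  { intros k; specialize (Hn k).
    assert (H1 := hyp_S a b c k Hc); assert (H2 := hyp_succ_bot a b c k Hc).
    assert (H3 : INR (S k) * hyp a b c (S k) =
      (a + INR k) * (b + INR k) * hyp a b c k / (c + INR k)).
    { rewrite <- H1, INR_C_S; field; auto. }
    assert (H4 : hyp a b (c + 1) k = c * hyp a b c k / (c + INR k)).
    { rewrite H2; field; auto. }
    rewrite H3, H4; field; auto. }
  induction n as [|n IH].
  - rewrite !Csum_O, (Ht 0%nat); simpl INR; ring.
  - rewrite !Csum_S, Cmult_plus_distr_l, IH, (Ht (S n)); ring.
Qed.

Lemma Clim_seq_sum_S (u : nat -> C) (l : C) (c : C) :
  Clim_seq u l -> Clim_seq (fun n => c * u (S n)) (c * l).
Proof.
  intros H; apply Clim_seq_mult; [apply Clim_seq_const|].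
  now apply Clim_seq_incr_1.
Qed.

Lemma is_hyp_contiguous (a b c v w : C) :
  ~ nonpos_int c -> (0 < Re (c - a - b))%R ->
  is_hyp a b c v -> is_hyp a b (c + 1) w ->
  c * (c - a - b) * v = (c - a) * (c - b) * w.
Proof.
  intros Hc H Hv Hw.
  apply Clim_seq_unique with (fun n => c * (c - a - b) * sum_n (hyp a b c) n).
  - apply Clim_seq_mult; [apply Clim_seq_const | exact Hv].
  - apply Clim_seq_ext with (fun n => (c - a) * (c - b) *
      sum_n (hyp a b (c + 1)) n + - c * (INR (S n) * hyp a b c (S n))).
    + intros n; rewrite hyp_contiguous by auto; ring.
    + replace ((c - a) * (c - b) * w) with ((c - a) * (c - b) * w + - c * 0)
        by ring.
      apply Clim_seq_plus.
      * apply Clim_seq_mult; [apply Clim_seq_const | exact Hw].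
      * apply (Clim_seq_sum_S (fun n => INR n * hyp a b c n)).
        now apply hyp_boundary.
Qed.

(** The contiguous relation holds for partial sums and can be solved for the sum at c, since c
    (c-a-b) is nonzero; convergence thus descends from c + 1 to c. *)
Lemma ex_hyp_pred (a b c w : C) :
  ~ nonpos_int c -> (0 < Re (c - a - b))%R ->
  is_hyp a b (c + 1) w -> exists v, is_hyp a b c v.
Proof.
  intros Hc H Hw.
  assert (H0 : c <> 0) by (intros H0; apply Hc; exists 0%nat; rewrite H0;
    simpl; ring).
  assert (H1 : c - a - b <> 0) by (intros H1; rewrite H1 in H; simpl in H; lra).
  exists (/ (c * (c - a - b)) * ((c - a) * (c - b) * w + - c * 0)).
  apply Clim_seq_ext with (fun n => / (c * (c - a - b)) * ((c - a) * (c - b) *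
    sum_n (hyp a b (c + 1)) n + - c * (INR (S n) * hyp a b c (S n)))).
  - intros n.
    replace (_ + _) with (c * (c - a - b) * sum_n (hyp a b c) n)
      by (rewrite hyp_contiguous by auto; ring).
    field; auto.
  - apply Clim_seq_mult; [apply Clim_seq_const|].
    apply Clim_seq_plus.
    + apply Clim_seq_mult; [apply Clim_seq_const | exact Hw].
    + apply (Clim_seq_sum_S (fun n => INR n * hyp a b c n)).
      now apply hyp_boundary.
Qed.

(** Raising c by N adds N to Re (c-a-b), which reaches the range of absolute convergence;
    [ex_hyp_pred] leads back down one unit at a time. *)
Lemma ex_hyp (a b c : C) :
  ~ nonpos_int c -> (0 < Re (c - a - b))%R -> exists v, is_hyp a b c v.
Proof.
  intros Hc H.
  assert (Hind : forall N c, ~ nonpos_int c -> (0 < Re (c - a - b))%R ->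
    (1 <= Re (c - a - b) + INR N)%R -> exists v, is_hyp a b c v).
  { clear c Hc H; intros N; induction N as [|N IH]; intros c Hc H HN.
    - apply ex_Clim_seq_abs with (fun n => Cmod (hyp a b c n)).
      + intros n; apply Rle_refl.
      + apply hyp_abs_summable; auto; change (INR 0) with 0%R in HN; lra.
    - destruct (IH (c + 1)) as [w Hw].
      + intros H1; now apply Hc, (nonpos_int_add c 1).
      + revert H; unfold Re; simpl; lra.
      + rewrite S_INR in HN; revert HN; unfold Re; simpl; lra.
      + now apply ex_hyp_pred with w. }
  destruct (INR_unbounded 1) as [N HN].
  apply (Hind N); auto; lra.
Qed.

Lemma is_hyp_shift (a b c v w : C) (N : nat) :
  ~ nonpos_int c -> (0 < Re (c - a - b))%R ->
  is_hyp a b c v -> is_hyp a b (c + INR N) w ->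
  poch c N * poch (c - a - b) N * v = poch (c - a) N * poch (c - b) N * w.
Proof.
  intros Hc H Hv; revert w; induction N as [|N IH]; intros w Hw.
  - simpl in *; rewrite Cplus_0_r in Hw.
    rewrite (Clim_seq_unique _ _ _ Hv Hw); ring.
  - assert (Hc' : ~ nonpos_int (c + INR N))
      by (intros H1; now apply Hc, (nonpos_int_add c N)).
    assert (H' : (0 < Re (c + INR N - a - b))%R).
    { revert H; generalize (pos_INR N); unfold Re; simpl. lra. }
    destruct (ex_hyp a b (c + INR N) Hc' H') as [u Hu].
    rewrite INR_C_S, Cplus_assoc in Hw.
    assert (Hs := is_hyp_contiguous a b (c + INR N) u w Hc' H' Hu Hw).
    specialize (IH u Hu); simpl.
    replace (poch c N * (c + INR N) *
      (poch (c - a - b) N * (c - a - b + INR N)) * v) with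
      ((c + INR N) * (c - a - b + INR N) *
       (poch c N * poch (c - a - b) N * v)) by ring.
    rewrite IH.
    replace ((c + INR N) * (c - a - b + INR N) *
      (poch (c - a) N * poch (c - b) N * u)) with
      (poch (c - a) N * poch (c - b) N *
        ((c + INR N) * (c + INR N - a - b) * u)) by ring.
    rewrite Hs; ring.
Qed.

(* Comparison with a real bottom parameter [c0] for which the series converges
   absolutely; the factor [1 / Re (c + N)] comes from the first factor
   of the bottom Pochhammer symbol. *)
Lemma is_hyp_large_bot (a b c : C) : exists K N0, forall N w,
  (N0 <= N)%nat -> is_hyp a b (c + INR N) w ->
  (0 < Re c + INR N)%R /\ (Cmod (w - 1) <= K / (Re c + INR N))%R.
Proof.
  (* [N0] is so large that the real parameter x = Re c + N0 is positive and x - Re (a+b) >= 1, as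
     [hyp_abs_summable] requires. *)
  destruct (INR_unbounded (Rabs (Re c) + Rabs (Re (a + b)) + 1)) as [N0 HN0].
  set (x := (Re c + INR N0)%R).
  assert (Hx : (0 < x)%R /\ (1 <= x - Re (a + b))%R).
  { unfold x; generalize (Rle_abs (- Re c)) (Rle_abs (Re (a + b)))
      (Rabs_pos (Re (a + b))); rewrite Rabs_Ropp; lra. }
  destruct Hx as [Hx0 Hx1].
  assert (Hnx : ~ nonpos_int (RtoC x)) by (apply Re_pos_not_nonpos_int; auto).
  assert (Hsum : ex_series (fun n => Cmod (hyp a b x n))).
  { apply hyp_abs_summable; auto.
    revert Hx1; unfold Re; simpl; lra. }
  apply ex_series_incr_1 in Hsum.
  set (T := Series (fun n => Cmod (hyp a b x (S n)))).
  exists (x * T)%R, N0; intros N w HN Hw.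
  assert (Hy : (x <= Re c + INR N)%R)
    by (unfold x; apply le_INR in HN; lra).
  assert (Hre : Re (c + INR N) = (Re c + INR N)%R) by reflexivity.
  set (y := (Re c + INR N)%R) in *.
  split; [lra|].
  assert (Hny : ~ nonpos_int (c + INR N)).
  { apply Re_pos_not_nonpos_int; rewrite Hre; lra. }
  (* The first factors satisfy y <= |c+N|, which yields the gain x/y; the later ones only need x + j
     <= y + j <= |c+N+j|. *)
  assert (Hpoch : forall n, (y * Cmod (poch x (S n)) <=
    x * Cmod (poch (c + INR N) (S n)))%R).
  { intros n; induction n as [|n IH].
    - simpl poch; rewrite !Cmult_1_l, !Cplus_0_r, Cmod_R, Rabs_pos_eq by lra.
      rewrite Rmult_comm; apply Rmult_le_compat_l; [lra|].
      apply Rle_trans with (2 := re_le_Cmod _).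
      apply Rle_trans with (2 := Rle_abs _); rewrite Hre; lra.
    - change (poch ?z (S (S n))) with (poch z (S n) * (z + INR (S n))).
      rewrite !Cmod_mult, <- !Rmult_assoc.
      apply Rmult_le_compat; auto using Cmod_ge_0.
      + apply Rmult_le_pos; [lra | apply Cmod_ge_0].
      + rewrite <- RtoC_plus, Cmod_R, Rabs_pos_eq
          by (generalize (pos_INR (S n)); lra).
        apply Rle_trans with (2 := re_le_Cmod _).
        apply Rle_trans with (2 := Rle_abs _).
        rewrite re_plus, Hre, re_RtoC; lra. }
  assert (Hterm : forall n, (Cmod (hyp a b (c + INR N) (S n)) <=
     x / y * Cmod (hyp a b x (S n)))%R).
  { intros n; unfold hyp.
    assert (H1 := proj1 (Cmod_gt_0 _) (poch_nz _ (S n) Hny)).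
    assert (H2 := proj1 (Cmod_gt_0 _) (poch_nz _ (S n) Hnx)).
    assert (H3 := proj1 (Cmod_gt_0 _) (fact_C_nz (S n))).
    rewrite !Cmod_div, !(Cmod_mult (poch _ _) (RtoC _))
      by (apply Cmult_neq_0; auto using poch_nz, fact_C_nz).
    set (P := Cmod (_ * _)); assert (HP : (0 <= P)%R) by apply Cmod_ge_0.
    replace (x / y * (P / (Cmod (poch x (S n)) * Cmod (INR (fact (S n))))))%R
      with (P * / Cmod (INR (fact (S n))) * (x / (y * Cmod (poch x (S n)))))%R
      by (field; lra).
    replace (P / (Cmod (poch (c + INR N) (S n)) * Cmod (INR (fact (S n)))))%R
      with (P * / Cmod (INR (fact (S n))) * / Cmod (poch (c + INR N) (S n)))%R
      by (field; lra).
    apply Rmult_le_compat_l.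
    - apply Rmult_le_pos; auto; left; now apply Rinv_0_lt_compat.
    - specialize (Hpoch n).
      replace (/ Cmod (poch (c + INR N) (S n)))%R
        with (x / (x * Cmod (poch (c + INR N) (S n))))%R by (field; lra).
      apply Rmult_le_compat_l; [lra|].
      apply Rinv_le_contravar; auto; apply Rmult_lt_0_compat; lra. }
  apply Clim_seq_Cmod_le with
    (fun n => sum_n (fun k => hyp a b (c + INR N) (S k)) n).
  - intros n.
    eapply Rle_trans; [apply Cmod_Csum_le, Hterm|].
    replace (x * T / y)%R with (x / y * T)%R by (field; lra).
    rewrite (sum_n_mult_l (K := R_Ring)).
    apply Rmult_le_compat_l.
    + left; apply Rdiv_lt_0_compat; lra.
    + unfold T.
      apply (is_lim_seq_incr_compare (sum_n (fun n => Cmod (hyp a b x (S n))))).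
      * exact (Series_correct _ Hsum).
      * intros k; rewrite sum_Sn; change plus with Rplus.
        generalize (Cmod_ge_0 (hyp a b x (S (S k)))); lra.
  - apply Clim_seq_ext with
      (fun n => sum_n (hyp a b (c + INR N)) (S n) + - (1)).
    + intros n; rewrite Csum_S_l, hyp_0; ring.
    + apply Clim_seq_plus; [|apply Clim_seq_const].
      now apply Clim_seq_incr_1.
Qed.

(** The shift N of the bottom parameter doubles as the index of Euler's limit: in the shifted
    identity the factorials agree on both sides, and so do the powers of N, because (c-1) +
    (c-a-b-1) = (c-a-1) + (c-b-1). What remains is a relation between approximants with the factor
    F(c+N). Stated with 1/Gamma it also covers poles at c - a and c - b. *)
Theorem Gauss_summation (a b c v : C) :
  ~ nonpos_int c -> (0 < Re (c - a - b))%R -> is_hyp a b c v ->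
  rGamma c * rGamma (c - a - b) * v = rGamma (c - a) * rGamma (c - b).
Proof.
  intros Hc H Hv.
  assert (Hprod : forall x y, Clim_seq
    (fun n => rGamma_approx x n * rGamma_approx y n) (rGamma x * rGamma y)).
  { intros x y; apply Clim_seq_mult; apply rGamma_lim. }
  apply Clim_seq_unique with
    (fun n => rGamma_approx c n * rGamma_approx (c - a - b) n * v).
  { apply Clim_seq_mult; [apply Hprod | apply Clim_seq_const]. }
  assert (Heq : forall n w, is_hyp a b (c + INR n) w ->
    rGamma_approx c n * rGamma_approx (c - a - b) n * v =
    rGamma_approx (c - a) n * rGamma_approx (c - b) n * w).
  { intros n w Hw; assert (Hs := is_hyp_shift a b c v w n Hc H Hv Hw).
    unfold rGamma_approx.
    assert (Hpow : nat_cpow n (c - 1) * nat_cpow n (c - a - b - 1) =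
      nat_cpow n (c - a - 1) * nat_cpow n (c - b - 1)).
    { rewrite !nat_cpow_Cexp, <- !Cexp_plus; f_equal; ring. }
    generalize (fact_C_nz n) (nat_cpow_nz n (c - 1))
      (nat_cpow_nz n (c - a - b - 1)) (nat_cpow_nz n (c - a - 1))
      (nat_cpow_nz n (c - b - 1)); intros.
    transitivity (poch c n * poch (c - a - b) n * v / (INR (fact n) *
      INR (fact n) * (nat_cpow n (c - 1) * nat_cpow n (c - a - b - 1)))).
    { field; auto. }
    rewrite Hs, Hpow; field; auto. }
  destruct (is_hyp_large_bot a b c) as [K [N0 HK]].
  destruct (Clim_seq_bounded _ _ (Hprod (c - a) (c - b))) as [B [HB0 HB]].
  set (d := rGamma (c - a) * rGamma (c - b)).
  replace d with (d + 0) by ring.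
  (* The sums F(c+n) are given only by an existence statement, one n at a time. Instead of a
     sequence of them, the difference of two explicit sequences is shown to vanish; it equals a
     bounded factor times F(c+n) - 1. *)
  apply Clim_seq_ext with (fun n =>
    rGamma_approx (c - a) n * rGamma_approx (c - b) n +
    (rGamma_approx c n * rGamma_approx (c - a - b) n * v -
     rGamma_approx (c - a) n * rGamma_approx (c - b) n)).
  { intros n; ring. }
  apply Clim_seq_plus; [apply Hprod|].
  apply Clim_seq_squeeze with (fun n => (B * K * / (Re c + INR n))%R).
  - exists N0; intros n Hn.
    assert (Hc' : ~ nonpos_int (c + INR n))
      by (intros H1; now apply Hc, (nonpos_int_add c n)).
    assert (H' : (0 < Re (c + INR n - a - b))%R).
    { revert H; generalize (pos_INR n); unfold Re; simpl; lra. }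
    destruct (ex_hyp a b (c + INR n) Hc' H') as [w Hw].
    destruct (HK n w Hn Hw) as [Hp Hle].
    rewrite (Heq n w Hw).
    replace (_ - _) with
      (rGamma_approx (c - a) n * rGamma_approx (c - b) n * (w - 1)) by ring.
    rewrite Cmod_mult, Rmult_assoc.
    apply Rmult_le_compat; auto using Cmod_ge_0.
  - replace (Finite 0) with (Rbar_mult (B * K)%R 0%R)
      by (simpl; f_equal; ring).
    apply is_lim_seq_scal_l.
    apply (is_lim_seq_inv _ p_infty); [|discriminate].
    eapply is_lim_seq_plus; [apply is_lim_seq_const | apply is_lim_seq_INR |].
    reflexivity.
Qed.

(** * Newton interpolation *)

Fixpoint fdiff (k : nat) (P : nat -> C) : nat -> C :=
  match k with
  | O => P
  | S k' => fdiff k' (fun n => P (S n) - P n)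
  end.

(* [P] is a polynomial of degree less than [d] in [n]. *)
Definition deg_lt (d : nat) (P : nat -> C) : Prop := forall n, fdiff d P n = 0.

Lemma fdiff_ext (k : nat) (P Q : nat -> C) (n : nat) :
  (forall i, P i = Q i) -> fdiff k P n = fdiff k Q n.
Proof.
  revert P Q; induction k as [|k IH]; intros P Q H; simpl; auto.
  apply IH; intros i; now rewrite !H.
Qed.

Lemma fdiff_plus (k : nat) (P Q : nat -> C) (n : nat) :
  fdiff k (fun i => P i + Q i) n = fdiff k P n + fdiff k Q n.
Proof.
  revert P Q; induction k as [|k IH]; intros P Q; simpl; auto.
  rewrite <- IH; apply fdiff_ext; intros i; ring.
Qed.

Lemma fdiff_shift (k : nat) (P : nat -> C) (n : nat) :
  fdiff k (fun i => P (S i)) n = fdiff k P (S n).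
Proof.
  revert P; induction k as [|k IH]; intros P; simpl; auto.
  now rewrite <- IH.
Qed.

Lemma fdiff_scal (k : nat) (c : C) (P : nat -> C) (n : nat) :
  fdiff k (fun i => c * P i) n = c * fdiff k P n.
Proof.
  revert P; induction k as [|k IH]; intros P; simpl; auto.
  rewrite <- IH; apply fdiff_ext; intros i; ring.
Qed.

Lemma deg_lt_ext (d : nat) (P Q : nat -> C) :
  (forall n, P n = Q n) -> deg_lt d P -> deg_lt d Q.
Proof.
  intros H HP n; rewrite <- (HP n); now apply fdiff_ext.
Qed.

(** Discrete Leibniz rule: the difference of (x+n) P(n) is (x+n) (P(n+1) - P(n)) + P(n+1), where
    induction applies to the first summand and the hypothesis to the second. *)
Lemma deg_lt_mult_linear (d : nat) (x : C) (P : nat -> C) :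
  deg_lt d P -> deg_lt (S d) (fun n => (x + INR n) * P n).
Proof.
  revert P; induction d as [|d IH]; intros P HP n; simpl.
  - assert (H : forall i, P i = 0) by exact HP.
    rewrite !H; ring.
  - change (fdiff (S d) (fun i => (x + INR (S i)) * P (S i) -
      (x + INR i) * P i) n = 0).
    rewrite (fdiff_ext _ _
      (fun i => (x + INR i) * (P (S i) - P i) + P (S i))).
    + rewrite fdiff_plus, fdiff_shift, (HP (S n)).
      rewrite (IH (fun i => P (S i) - P i) HP n); ring.
    + intros i; rewrite INR_C_S; ring.
Qed.

Lemma deg_lt_mult_poch (d e : nat) (x : C) (P : nat -> C) :
  deg_lt d P -> deg_lt (e + d) (fun n => poch (x + INR n) e * P n).
Proof.
  intros HP; induction e as [|e IH]; simpl.
  - apply deg_lt_ext with (2 := HP); intros n; ring.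
  - apply deg_lt_ext with
      (2 := deg_lt_mult_linear _ (x + INR e) _ IH); intros n; ring.
Qed.

(** The product n (n-1) ... (n-k+1), written with [poch] so that its splitting and vanishing
    properties carry over. *)
Definition falling (n k : nat) : C := (- (1)) ^ k * poch (- INR n) k.

Lemma falling_S_S (n k : nat) : falling (S n) (S k) = (INR n + 1) * falling n k.
Proof.
  unfold falling; rewrite poch_S_l, INR_C_S.
  replace (- (INR n + 1) + 1) with (- RtoC (INR n)) by ring.
  simpl; ring.
Qed.

Lemma falling_pascal (n k : nat) :
  falling (S n) (S k) = falling n (S k) + (INR k + 1) * falling n k.
Proof. rewrite falling_S_S; unfold falling; simpl; ring. Qed.

Lemma falling_0_S (k : nat) : falling 0 (S k) = 0.
Proof.
  unfold falling; rewrite (poch_nonpos_int 0 (S k)) by lia; ring.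
Qed.

Lemma falling_fact (n k : nat) :
  INR (fact n) * falling (k + n) k = INR (fact (k + n)).
Proof.
  induction k as [|k IH]; [unfold falling; simpl; ring|].
  rewrite Nat.add_succ_l, falling_S_S, fact_C_S, <- IH; ring.
Qed.

(** Both sides agree at n = 0 and have the same forward difference: by [falling_pascal] differencing
    the expansion lowers each index by one, which gives the expansion of P(n+1) - P(n) known by
    induction on the degree. *)
Lemma Newton_interpolation (d : nat) (P : nat -> C) : deg_lt (S d) P ->
  forall n, P n =
    sum_n (fun k => fdiff k P 0 / INR (fact k) * falling n k) d.
Proof.
  revert P; induction d as [|d IH]; intros P HP.
  - assert (H0 : forall n, P n = P 0%nat).
    { induction n as [|n IHn]; auto.
      rewrite <- IHn; apply Ceq_minus; exact (HP n). }
    intros n; rewrite H0, Csum_O; unfold falling; simpl; field; apply C1_nz.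
  - assert (HD := IH (fun n => P (S n) - P n) HP).
    assert (HS : forall n, (sum_n
      (fun k => fdiff k P 0 / INR (fact k) * falling (S n) k) (S d) : C) =
      sum_n (fun k => fdiff k P 0 / INR (fact k) * falling n k) (S d) +
      (P (S n) - P n)).
    { intros n; rewrite HD, !Csum_S_l.
      rewrite <- Cplus_assoc, <- Csum_plus; apply (f_equal2 Cplus).
      - unfold falling; simpl; ring.
      - apply Csum_ext; intros k _; rewrite falling_pascal; simpl fdiff.
        rewrite fact_C_S; generalize (fact_C_nz k) (INR_C_S_nz k); intros.
        field; auto. }
    induction n as [|n IHn].
    + rewrite Csum_S_l, (Csum_ext _ (fun _ => 0 * 0)), (Csum_mult_l 0).
      * unfold falling; simpl; field; apply C1_nz.
      * intros k _; rewrite falling_0_S; ring.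
    + rewrite HS, <- IHn; ring.
Qed.

(** The binomial formula for iterated differences, with the signed binomial coefficient written as
    (-k)_i / i! to match the hypergeometric sum in [Ccoef]. *)
Lemma fdiff_sum (k : nat) (P : nat -> C) (n : nat) :
  fdiff k P n = (- (1)) ^ k *
    sum_n (fun i => poch (- INR k) i / INR (fact i) * P (n + i)%nat) k.
Proof.
  revert P; induction k as [|k IH]; intros P.
  - rewrite Csum_O, Nat.add_0_r; simpl; field; apply C1_nz.
  - simpl fdiff; rewrite IH, Csum_S_l.
    (* Pascal's rule in the form (-k-1)_(i+1) / (i+1)! = (-k)_(i+1) / (i+1)! - (-k)_i / i!. *)
    rewrite (Csum_ext (fun i => poch (- INR (S k)) (S i) / _ * _)
      (fun i => poch (- INR k) (S i) / INR (fact (S i)) * P (n + S i)%nat +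
        - (1) * (poch (- INR k) i / INR (fact i) * P (n + S i)%nat))).
    2:{ intros i _; rewrite poch_S_l, fact_C_S, INR_C_S.
        replace (- (INR k + 1) + 1) with (- RtoC (INR k)) by ring.
        simpl poch; generalize (fact_C_nz i) (INR_C_S_nz i); intros.
        field; auto. }
    rewrite Csum_plus, Csum_mult_l.
    (* The sum may be extended to i = k + 1, since (-k)_(k+1) = 0; its term at 0 is then split
       off. *)
    assert (Hlast : (sum_n (fun i => poch (- INR k) i / INR (fact i) *
        P (n + i)%nat) k : C) =
      P n + sum_n (fun i => poch (- INR k) (S i) / INR (fact (S i)) *
        P (n + S i)%nat) k).
    { apply (eq_trans (A := C)) with (sum_n (fun i =>
        poch (- INR k) i / INR (fact i) * P (n + i)%nat) (S k)).
      - rewrite Csum_S, poch_nonpos_int by lia; unfold Cdiv; symmetry; ring.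
      - rewrite Csum_S_l, Nat.add_0_r; apply (f_equal2 Cplus); auto.
        simpl; field; apply C1_nz. }
    rewrite (Csum_ext _ (fun i =>
      poch (- INR k) i / INR (fact i) * P (n + S i)%nat +
      - (1) * (poch (- INR k) i / INR (fact i) * P (n + i)%nat))).
    2:{ intros i _; rewrite Nat.add_succ_r; ring. }
    rewrite Csum_plus, Csum_mult_l, Hlast, Nat.add_0_r; simpl.
    field; apply C1_nz.
Qed.

(** * The factor of the parameters f as a polynomial in the index *)

Definition quot_prod (f : nat -> C) (m : nat -> nat) (l : list nat) (n : nat) : C :=
  poch_prod (map (fun j => f j + INR (m j)) l) n / poch_prod (map f l) n.

Lemma poch_prod_cons (x : C) (l : list C) (n : nat) :
  poch_prod (x :: l) n = poch x n * poch_prod l n.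
Proof. reflexivity. Qed.

Lemma poch_prod_nz (l : list C) (n : nat) :
  (forall x, In x l -> ~ nonpos_int x) -> poch_prod l n <> 0.
Proof.
  induction l as [|x l IH]; intros H; [apply C1_nz|].
  rewrite poch_prod_cons; apply Cmult_neq_0.
  - apply poch_nz, H; now left.
  - apply IH; intros y Hy; apply H; now right.
Qed.

Lemma deg_lt_quot_prod (f : nat -> C) (m : nat -> nat) (l : list nat) :
  (forall j, In j l -> ~ nonpos_int (f j)) ->
  deg_lt (S (list_sum (map m l))) (quot_prod f m l).
Proof.
  induction l as [|j l IH]; intros Hl.
  - intros n; unfold quot_prod; simpl; unfold poch_prod; simpl; field.
  - assert (Hj : ~ nonpos_int (f j)) by (apply Hl; now left).
    assert (Hl' : forall i, In i l -> ~ nonpos_int (f i))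
      by (intros i Hi; apply Hl; now right).
    specialize (IH Hl'); intros n; simpl map; simpl list_sum.
    rewrite <- Nat.add_succ_r.
    rewrite (fdiff_ext _ _ (fun i => / poch (f j) (m j) *
      (poch (f j + INR i) (m j) * quot_prod f m l i))).
    + rewrite fdiff_scal, (deg_lt_mult_poch _ _ _ _ IH n); ring.
    + intros i; unfold quot_prod; simpl map; rewrite !poch_prod_cons.
      assert (Hnz : poch_prod (map f l) i <> 0).
      { apply poch_prod_nz; intros x Hx; apply in_map_iff in Hx.
        destruct Hx as [k [<- Hk]]; auto. }
      generalize (poch_nz _ i Hj) (poch_nz _ (m j) Hj); intros H1 H2.
      (* Both sides are (f_j)_(m_j+i), split after m_j factors or after i factors. *)
      assert (H3 : poch (f j) (m j) * poch (f j + INR (m j)) i =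
        poch (f j) i * poch (f j + INR i) (m j)).
      { rewrite <- !poch_add, Nat.add_comm; reflexivity. }
      replace (poch (f j + INR (m j)) i) with
        (poch (f j) i * poch (f j + INR i) (m j) / poch (f j) (m j))
        by (rewrite <- H3; field; auto).
      field; auto.
Qed.

(** The top parameter -k together with i! supplies the coefficients (-k)_i / i! of [fdiff_sum], so
    the terminating series defining C_k is a k-th difference at 0 up to sign. *)
Lemma Ccoef_fdiff (r : nat) (f : nat -> C) (m : nat -> nat) (k : nat) :
  Ccoef r f m k = fdiff k (quot_prod f m (seq 0 r)) 0 / INR (fact k).
Proof.
  unfold Ccoef; rewrite fdiff_sum.
  rewrite (Csum_ext (pFq_term _ _ _) (fun i => poch (- INR k) i /
    INR (fact i) * quot_prod f m (seq 0 r) (0 + i)%nat)).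
  - generalize (fact_C_nz k); intros; field; auto.
  - intros i _; unfold pFq_term, quot_prod, params, shifted_params.
    change (0 + i)%nat with i.
    rewrite poch_prod_cons, Cpow_1_l; unfold Cdiv; ring.
Qed.

(** * Summation of the Newton expansion term by term *)

Lemma Clim_series_S (u : nat -> C) (l : C) : u 0%nat = 0 ->
  Clim_seq (fun n => sum_n (fun k => u (S k)) n) l ->
  Clim_seq (fun n => sum_n u n) l.
Proof.
  intros H0 H; apply Clim_seq_incr_1.
  apply Clim_seq_ext with (2 := H); intros n.
  rewrite Csum_S_l, H0; symmetry; ring.
Qed.

Lemma Clim_series_shift (u : nat -> C) (l : C) (k : nat) :
  (forall n, (n < k)%nat -> u n = 0) ->
  Clim_seq (fun n => sum_n (fun i => u (k + i)%nat) n) l ->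
  Clim_seq (fun n => sum_n u n) l.
Proof.
  revert u; induction k as [|k IH]; intros u H0 H; auto.
  apply Clim_series_S; [apply H0; lia|].
  apply IH; auto; intros n Hn; apply H0; lia.
Qed.

Lemma Clim_series_sum (u : nat -> nat -> C) (l : nat -> C) (d : nat) :
  (forall k, (k <= d)%nat -> Clim_seq (fun n => sum_n (u k) n) (l k)) ->
  Clim_seq (fun n => sum_n (fun i => sum_n (fun k => u k i) d) n) (sum_n l d).
Proof.
  induction d as [|d IH]; intros H.
  - rewrite Csum_O; apply Clim_seq_ext with (2 := H 0%nat (Nat.le_refl 0)).
    intros n; apply Csum_ext; intros i _; now rewrite Csum_O.
  - rewrite Csum_S; apply Clim_seq_ext with (fun n =>
      sum_n (fun i => sum_n (fun k => u k i) d) n + sum_n (u (S d)) n).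
    + intros n; rewrite <- Csum_plus; apply Csum_ext; intros i _.
      now rewrite Csum_S.
    + apply Clim_seq_plus; [apply IH; auto | apply H; lia].
Qed.

(** The falling factorial reduces (k+n)! to n!, and each Pochhammer symbol splits after k factors:
    weighting by it shifts all three parameters by k. *)
Lemma hyp_falling (a b c : C) (k n : nat) : ~ nonpos_int c ->
  hyp a b c (k + n) * falling (k + n) k =
  poch a k * poch b k / poch c k * hyp (a + INR k) (b + INR k) (c + INR k) n.
Proof.
  intros Hc; unfold hyp; rewrite <- falling_fact, !poch_add.
  assert (Hc' : ~ nonpos_int (c + INR k))
    by (intros H1; now apply Hc, (nonpos_int_add c k)).
  generalize (poch_nz c k Hc) (poch_nz _ n Hc') (fact_C_nz n); intros.
  assert (falling (k + n) k <> 0).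
  { intros H2; apply (fact_C_nz (k + n)); rewrite <- falling_fact, H2; ring. }
  field; auto.
Qed.

(* [(a)_k Gamma (p + 1 - a - k) = (-1)^k (1 - a - k)_p Gamma (1 - a)], in a
   form that is free of poles. *)
Lemma poch_rGamma_reflect (a : C) (k p : nat) :
  poch a k * rGamma (1 - a) = (- (1)) ^ k * poch (1 - a - INR k) p *
    rGamma (1 - a - INR k + INR p).
Proof.
  rewrite <- Cmult_assoc, <- rGamma_poch.
  rewrite (rGamma_poch (1 - a - INR k) k), poch_reflect.
  replace (1 - a - INR k + INR k) with (1 - a) by ring.
  assert (H : (- (1)) ^ k * (- (1)) ^ k = 1).
  { rewrite <- Cpow_mult_l; replace (- (1) * - (1)) with (RtoC 1) by ring.
    apply Cpow_1_l. }
  rewrite !Cmult_assoc, H; ring.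
Qed.

(** With c = b + p + 1, Gauss's formula at the parameters shifted by k involves b - a + p + 1 and p
    + 1, both free of k. The other two arguments c + k and p + 1 - a - k are brought back to c and 1
    - a by [rGamma_poch] and [poch_rGamma_reflect], so that one common Gamma quotient serves all
    k. *)
Lemma hyp_falling_series (a b : C) (k p : nat) :
  ~ nonpos_int (b + INR (S p)) -> (0 < Re (INR (S p) - a - INR k))%R ->
  (0 < Re (1 - a))%R ->
  Clim_seq
    (fun n => sum_n (fun i => hyp a b (b + INR (S p)) i * falling i k) n)
    (Gamma (b + INR (S p)) * Gamma (1 - a) /
      (Gamma (b - a + INR (S p)) * INR (fact p)) *
     (poch b k * (- (1)) ^ k * poch (1 - a - INR k) p)).
Proof.
  set (c := b + INR (S p)); intros Hc Hk Ha.
  assert (Hck : ~ nonpos_int (c + INR k))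
    by (intros H1; now apply Hc, (nonpos_int_add c k)).
  assert (Hp : c + INR k - (a + INR k) - (b + INR k) = INR (S p) - a - INR k)
    by (unfold c; ring).
  destruct (ex_hyp (a + INR k) (b + INR k) (c + INR k)) as [F HF]; auto.
  { now rewrite Hp. }
  apply Clim_series_shift with k.
  { intros n Hn; unfold falling; rewrite poch_nonpos_int by auto; ring. }
  assert (HG := Gauss_summation _ _ _ F Hck ltac:(now rewrite Hp) HF).
  rewrite Hp in HG.
  replace (c + INR k - (a + INR k)) with (b - a + INR (S p)) in HG
    by (unfold c; ring).
  replace (c + INR k - (b + INR k)) with (RtoC (INR (S p))) in HG
    by (unfold c; ring).
  assert (HR := poch_rGamma_reflect a k p).
  replace (1 - a - INR k + INR p) with (INR (S p) - a - INR k) in HR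
    by (rewrite INR_C_S; ring).
  assert (Hfact := rGamma_fact p).
  assert (Hrc := rGamma_poch c k).
  assert (N1 := rGamma_nz _ Hck).
  assert (N2 := rGamma_nz _ (Re_pos_not_nonpos_int _ Hk)).
  assert (N3 := rGamma_nz _ (Re_pos_not_nonpos_int _ Ha)).
  assert (N4 := poch_nz c k Hc).
  assert (N5 := fact_C_nz p).
  rewrite !Gamma_rGamma, Hrc.
  set (g := rGamma (b - a + INR (S p))) in *.
  set (g1 := rGamma (INR (S p) - a - INR k)) in *.
  replace (_ * _ / (/ g * _) * _) with
    (poch a k * poch b k / poch c k * F).
  { apply Clim_seq_ext with (fun n => poch a k * poch b k / poch c k *
      sum_n (hyp (a + INR k) (b + INR k) (c + INR k)) n).
    - intros n; rewrite <- Csum_mult_l; apply Csum_ext; intros i _.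
      symmetry; now apply hyp_falling.
    - apply Clim_seq_mult; [apply Clim_seq_const | exact HF]. }
  assert (HF' : F = g / (INR (fact p) * rGamma (c + INR k) * g1)).
  { replace g with (INR (fact p) * (g * rGamma (INR (S p)))).
    - rewrite <- HG; field; auto.
    - transitivity (g * (INR (fact p) * rGamma (INR (S p)))); [ring|].
      rewrite Hfact; ring. }
  assert (HR' : poch a k = (- (1)) ^ k * poch (1 - a - INR k) p * g1 /
    rGamma (1 - a)) by (rewrite <- HR; field; auto).
  rewrite HF', HR'.
  (* If b - a + p + 1 is a pole of Gamma, then F = 0 by Gauss's formula, and the claimed value is a
     quotient by 0, hence also 0. *)
  destruct (classic (g = 0)) as [->|Hg].
  - unfold Cdiv; rewrite Cinv_0, !Cmult_0_l, Cinv_0; ring.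
  - field; repeat split; auto.
Qed.

Theorem theorem4 (a b : C) (r : nat) (m : nat -> nat) (f : nat -> C) (q : nat)
    (Hq : (q < total r m)%nat)
    (Ha : (Re (a + INR q) < 0)%R)
    (Hb : ~ nonpos_int (b + INR (total r m) - INR q))
    (Hf : forall j : nat, (j < r)%nat -> ~ nonpos_int (f j)) :
  is_pFq (a :: b :: shifted_params r f m)
         ((b + INR (total r m) - INR q) :: params r f)
         1
         (Gamma (b + INR (total r m) - INR q) * Gamma (1 - a) * Rpoly b r f m q a
          / (Gamma (b - a + INR (total r m) - INR q)
             * INR (fact (total r m - q - 1)))).
Proof.
  apply is_series_C.
  (* As q < M, the truncated subtraction is exact and M - q is the successor of [p]. *)
  set (M := total r m) in *; set (p := (M - q - 1)%nat).
  assert (HM : RtoC (INR M) = INR q + INR (S p))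
    by (rewrite <- INR_C_add; do 2 f_equal; unfold p; lia).
  replace (b + INR M - INR q) with (b + INR (S p)) in * by (rewrite HM; ring).
  replace (b - a + INR M - INR q) with (b - a + INR (S p)) by (rewrite HM; ring).
  assert (Hf' : forall j, In j (seq 0 r) -> ~ nonpos_int (f j)).
  { intros j Hj; apply in_seq in Hj; apply Hf; lia. }
  assert (HaR : (Re a + INR q < 0)%R) by exact Ha.
  assert (HN := Newton_interpolation _ _ (deg_lt_quot_prod f m (seq 0 r) Hf')).
  change (list_sum (map m (seq 0 r))) with M in HN.
  (* The factor coming from f is replaced by its Newton expansion, leaving a finite combination of
     weighted 2F1 series that can be summed separately. *)
  apply Clim_seq_ext with (fun n => sum_n (fun i => sum_n (fun k =>
    Ccoef r f m k * (hyp a b (b + INR (S p)) i * falling i k)) M) n).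
  { intros n; apply Csum_ext; intros i _.
    rewrite (Csum_ext _ (fun k => hyp a b (b + INR (S p)) i *
      (fdiff k (quot_prod f m (seq 0 r)) 0 / INR (fact k) * falling i k))).
    2:{ intros k _; rewrite Ccoef_fdiff; ring. }
    rewrite Csum_mult_l, <- HN.
    unfold hyp, pFq_term, quot_prod, params, shifted_params.
    rewrite !poch_prod_cons, Cpow_1_l.
    assert (Hnz : poch_prod (map f (seq 0 r)) i <> 0).
    { apply poch_prod_nz; intros x Hx; apply in_map_iff in Hx.
      destruct Hx as [j [<- Hj]]; auto. }
    generalize (poch_nz _ i Hb) (fact_C_nz i); intros; field; auto. }
  set (G := Gamma (b + INR (S p)) * Gamma (1 - a) /
    (Gamma (b - a + INR (S p)) * INR (fact p))).
  replace (_ / _) with (sum_n (fun k => Ccoef r f m k *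
    (G * (poch b k * (- (1)) ^ k * poch (1 - a - INR k) p))) M : C).
  - apply Clim_series_sum with
      (u := fun k i => Ccoef r f m k * (hyp a b (b + INR (S p)) i * falling i k)).
    intros k Hk.
    apply Clim_seq_ext with (fun n => Ccoef r f m k *
      sum_n (fun i => hyp a b (b + INR (S p)) i * falling i k) n).
    { intros n; now rewrite Csum_mult_l. }
    apply Clim_seq_mult; [apply Clim_seq_const|].
    apply hyp_falling_series; auto.
    + apply le_INR in Hk.
      assert (HM' : INR M = (INR q + INR (S p))%R)
        by (rewrite <- plus_INR; f_equal; unfold p; lia).
      change (0 < INR (S p) + - Re a + - INR k)%R; lra.
    + change (0 < 1 + - Re a)%R; generalize (pos_INR q); lra.
  - unfold Rpoly; fold M; fold p.
    transitivity (G * sum_n (fun k => poch b k * Ccoef r f m k *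
      (- (1)) ^ k * poch (1 - a - INR k) p) M).
    + rewrite <- Csum_mult_l; apply Csum_ext; intros k _; ring.
    + unfold G, Cdiv; ring.
Qed.
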